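(* Let $\mathfrak g$ be simple of type ${\rm D}_n$ with $n\ge6$ even, $\pi'=\pi\setminus\{\alpha_n\}$, and $\mathfrak p=\mathfrak p^-_{\pi',\Lambda}$. With $S$, $T$, $\mathcal B'$ and $\operatorname{ch}\mathcal A$ as in the context, the improved upper bound $\mathcal B'$ for $\operatorname{ch}Y(\mathfrak p)$ is equal to the lower bound $\operatorname{ch}\mathcal A$, and is given by $$(1-e^{-2\varpi_n})^{-3}(1-e^{-4\varpi_n})^{-(n/2-2)}.$$
   Context: $k$ is algebraically closed of characteristic zero; $\mathfrak h$ is a Cartan subalgebra of $\mathfrak g$, $\Delta$ the root system, $\pi=\{\alpha_1,\dots,\alpha_n\}$ the simple roots (Bourbaki labelling), $\alpha_i=\varepsilon_i-\varepsilon_{i+1}$ $(i<n)$, $\alpha_n=\varepsilon_{n-1}+\varepsilon_n$, with fundamental weights $\varpi_i=\varpi_{\alpha_i}$. Let $\mathfrak n^-$ be the sum of the negative root spaces and $\mathfrak n_{\pi'}$ the sum of the root spaces for the positive roots in the root subsystem generated by $\pi'$. Then $\mathfrak p^-_{\pi',\Lambda}=\mathfrak n^-\oplus\mathfrak h_\Lambda\oplus\mathfrak n_{\pi'}$ (canonical truncation of $\mathfrak n^-\oplus\mathfrak h\oplus\mathfrak n_{\pi'}$), where $\mathfrak h_\Lambda$ is the span of the coroots $\alpha_i^\vee$, $1\le i\le n-1$. $Y(\mathfrak p)=S(\mathfrak p)^{\mathfrak p}$ denotes the Poisson centre. Lower bound. Let $w_0$, $w_0'$ be the longest elements of the Weyl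 groups of $\pi$ and $\pi'$. Put ${\bf j}(\alpha)=-w_0(\alpha)$ for $\alpha\in\pi$ and ${\bf i}(\alpha)=-w_0'(\alpha)$ for $\alpha\in\pi'$; for $\alpha\in\pi\setminus\pi'$ let $r\in\mathbb N$ be the smallest integer with ${\bf j}({\bf ij})^r(\alpha)\notin\pi'$ and put ${\bf i}(\alpha)={\bf j}({\bf ij})^r(\alpha)$. Let $E(\pi')$ be the set of $\langle{\bf ij}\rangle$-orbits in $\pi$. Let $\varpi'_\alpha$ $(\alpha\in\pi')$ be the fundamental weights for $\pi'$, viewed in the $\mathbb Q$-span of $\pi'$. For $\Gamma\in E(\pi')$ put $\delta_\Gamma=-\sum_{\gamma\in\Gamma}\varpi_\gamma-\sum_{\gamma\in{\bf j}(\Gamma)}\varpi_\gamma+\sum_{\gamma\in\Gamma\cap\pi'}\varpi'_\gamma+\sum_{\gamma\in{\bf i}(\Gamma\cap\pi')}\varpi'_\gamma$, and $\operatorname{ch}\mathcal A=\prod_{\Gamma\in E(\pi')}(1-e^{\delta_\Gamma})^{-1}$. The sets. $S=\{\varepsilon_{2i-1}+\varepsilon_{2i},\ \varepsilon_{n-3}+\varepsilon_{n-1},\ \varepsilon_n-\varepsilon_{n-3},\ \varepsilon_{n-2}-\varepsilon_{n-4},\ \varepsilon_{n-4}-\varepsilon_{n-5},\ \varepsilon_{n-3}-\varepsilon_{n-6},\ \varepsilon_{n-2j}-\varepsilon_{n-2j-2}\mid 1\le i\le n/2-2,\ 3\le j\le n/2-2\}$, where the element $\varepsilon_{n-3}-\varepsilon_{n-6}$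 is omitted when $n=6$. The restrictions to $\mathfrak h_\Lambda$ of the elements of $S$ form a basis of $\mathfrak h_\Lambda^*$. $T=\{\varepsilon_{n-3}-\varepsilon_{n-1},\ \varepsilon_{n-2}+\varepsilon_n,\ \varepsilon_n-\varepsilon_{n-5},\ \varepsilon_{n-3}-\varepsilon_{n-4},\ \varepsilon_{n-2k}-\varepsilon_{n-2k-1}\mid 3\le k\le n/2-1\}$. Improved upper bound. For $\gamma\in T$ let $t(\gamma)$ be the unique element of $\mathbb QS$ such that $\gamma+t(\gamma)$ vanishes on $\mathfrak h_\Lambda$ (equivalently is a multiple of $\varpi_n$). Then $\mathcal B'=\prod_{\gamma\in T}(1-e^{-(\gamma+t(\gamma))})^{-1}$. *)

(* Defs.v *)
From HB Require Import structures.
From mathcomp Require Import all_boot all_order all_algebra.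
From mathcomp Require Import finmap.
From mathcomp Require Import all_classical.

Set Implicit Arguments.
Unset Strict Implicit.
Unset Printing Implicit Defensive.

Import GRing.Theory.
Local Open Scope ring_scope.

(** The root system of type D_n is realised in coordinates: the dual h^* of the
    Cartan subalgebra is ['rV[k]_n], with the [eps i] as standard basis, and h is
    ['cV[k]_n], paired with h^* by the matrix product. *)

(* Indices are 1-based: [eps i] is the i-th basis vector for 1 <= i <= n (and is
   0 for the other values of i, which never contribute below). *)
Definition eps (k : fieldType) (n i : nat) : 'rV[k]_n :=
  \row_(j < n) (j.+1 == i)%:R.

Definition simple (k : fieldType) (n i : nat) : 'rV[k]_n :=
  if (i < n)%N then eps k n i - eps k n i.+1 else eps k n n.-1 + eps k n n.

Definition simple_roots (k : fieldType) (n : nat) : seq 'rV[k]_n :=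
  [seq simple k n i | i <- index_iota 1 n.+1].

(* pi' = pi minus alpha_n *)
Definition simple_roots' (k : fieldType) (n : nat) : seq 'rV[k]_n :=
  [seq simple k n i | i <- index_iota 1 n].

Definition pairing (k : fieldType) (n : nat) (v : 'rV[k]_n) (H : 'cV[k]_n) : k :=
  (v *m H) 0 0.

Definition coroot (k : fieldType) (n : nat) (a : 'rV[k]_n) : 'cV[k]_n :=
  (2 / pairing a a^T) *: a^T.

(* v *m refl a = v - <v, a^vee> a: matrices act on weights from the right. *)
Definition refl (k : fieldType) (n : nat) (a : 'rV[k]_n) : 'M[k]_n :=
  1%:M - coroot a *m a.

(** Weyl group generated by the reflections in [P], and its longest element for
    the Coxeter length (the least length of a word in the simple reflections). *)

Definition is_word (k : fieldType) (n : nat) (P : seq 'rV[k]_n)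
    (w : 'M[k]_n) (s : seq 'rV[k]_n) : Prop :=
  {subset s <= P} /\ w = \big[mulmx/1%:M]_(a <- s) refl a.

Definition has_length (k : fieldType) (n : nat) (P : seq 'rV[k]_n)
    (w : 'M[k]_n) (l : nat) : Prop :=
  (exists2 s, is_word P w s & size s = l) /\
  (forall s, is_word P w s -> (l <= size s)%N).

Definition is_longest (k : fieldType) (n : nat) (P : seq 'rV[k]_n)
    (w : 'M[k]_n) : Prop :=
  exists2 l, has_length P w l &
    forall w' l', has_length P w' l' -> (l' <= l)%N.

Definition longest (k : fieldType) (n : nat) (P : seq 'rV[k]_n) : 'M[k]_n :=
  xget 1%:M [set w | is_longest P w]%classic.

Definition jmap (k : fieldType) (n : nat) (a : 'rV[k]_n) : 'rV[k]_n :=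
  - (a *m longest (simple_roots k n)).

Definition imap' (k : fieldType) (n : nat) (a : 'rV[k]_n) : 'rV[k]_n :=
  - (a *m longest (simple_roots' k n)).

Definition jij (k : fieldType) (n : nat) (a : 'rV[k]_n) (r : nat) : 'rV[k]_n :=
  jmap (iter r (fun b => imap' (jmap b)) a).

(* Outside pi' the least r with j(ij)^r(a) not in pi' is used.  Up to that r, the
   map i is only ever applied to elements of pi', so that [jij], which is written
   with [imap'], computes j(ij)^r there. *)
Definition imap (k : fieldType) (n : nat) (a : 'rV[k]_n) : 'rV[k]_n :=
  if a \in simple_roots' k n then imap' a
  else match pselect (exists r, jij a r \notin simple_roots' k n) with
       | left ex_r => jij a (ex_minn ex_r)
       | right _ => a
       end.

Definition ij_related (k : fieldType) (n : nat) (a b : 'rV[k]_n) : Prop :=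
  exists m : nat, b = iter m (fun c => imap (jmap c)) a \/
                  a = iter m (fun c => imap (jmap c)) b.

Definition ij_orbit (k : fieldType) (n : nat) (a : 'rV[k]_n) : {fset 'rV[k]_n} :=
  [fset b in simple_roots k n | `[< ij_related a b >]]%fset.

Definition Epi' (k : fieldType) (n : nat) : {fset {fset 'rV[k]_n}} :=
  [fset ij_orbit a | a in simple_roots k n]%fset.

Definition Qspan (k : fieldType) (n : nat) (P : seq 'rV[k]_n) (v : 'rV[k]_n) :
    Prop :=
  exists c : 'rV[k]_n -> rat, v = \sum_(u <- P) ratr (c u) *: u.

(* The fundamental weight of a in P, viewed in the Q-span of P. *)
Definition fund_weight (k : fieldType) (n : nat) (P : seq 'rV[k]_n)
    (a : 'rV[k]_n) : 'rV[k]_n :=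
  xget 0 [set v | Qspan P v /\
                  {in P, forall b, pairing v (coroot b) = (b == a)%:R}]%classic.

Definition varpi (k : fieldType) (n : nat) (a : 'rV[k]_n) : 'rV[k]_n :=
  fund_weight (simple_roots k n) a.

Definition varpi' (k : fieldType) (n : nat) (a : 'rV[k]_n) : 'rV[k]_n :=
  fund_weight (simple_roots' k n) a.

Definition delta (k : fieldType) (n : nat) (G : {fset 'rV[k]_n}) : 'rV[k]_n :=
  let G' := [fset g in G | g \in simple_roots' k n]%fset in
  - (\sum_(g <- G) varpi g)
  - (\sum_(g <- [fset jmap g | g in G]%fset) varpi g)
  + \sum_(g <- G') varpi' g
  + \sum_(g <- [fset imap g | g in G']%fset) varpi' g.

(** Formal characters: [f] stands for the formal sum of the f(mu) e^mu. *)

Definition fchar (k : fieldType) (n : nat) := 'rV[k]_n -> int.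

Definition fone (k : fieldType) (n : nat) : fchar k n := fun mu => (mu == 0)%:R.

Arguments fone : clear implicits.

(* Cauchy product; the sum is meaningful when only finitely many of its terms are
   nonzero, which is the case for series supported in a common strict cone. *)
Definition fmul (k : fieldType) (n : nat) (f g : fchar k n) : fchar k n :=
  fun mu => \sum_(nu \in [set: 'rV[k]_n]%classic) (f nu * g (mu - nu)).

Definition fexp (k : fieldType) (n : nat) (f : fchar k n) (m : nat) : fchar k n :=
  iter m (fmul f) (fone k n).

(* (1 - e^lam)^-1 = sum over m >= 0 of e^(m lam), for lam nonzero (the multiples
   m lam are then distinct in characteristic zero). *)
Definition geom (k : fieldType) (n : nat) (lam : 'rV[k]_n) : fchar k n :=
  fun mu => `[< exists m : nat, mu = lam *+ m >]%:R.

Definition chA (k : fieldType) (n : nat) : fchar k n :=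
  \big[@fmul k n/fone k n]_(G <- Epi' k n) geom (delta G).

Arguments chA : clear implicits.

Definition hLambda (k : fieldType) (n : nat) : {vspace 'cV[k]_n} :=
  <<[seq coroot a | a <- simple_roots' k n]>>%VS.

Definition roots_S (k : fieldType) (n : nat) : seq 'rV[k]_n :=
  let e := eps k n in
  [seq e (2 * i - 1)%N + e (2 * i)%N | i <- index_iota 1 (n./2 - 1)]
  ++ [:: e (n - 3)%N + e (n - 1)%N; e n - e (n - 3)%N;
         e (n - 2)%N - e (n - 4)%N; e (n - 4)%N - e (n - 5)%N]
  ++ (if n == 6%N then [::] else [:: e (n - 3)%N - e (n - 6)%N])
  ++ [seq e (n - 2 * j)%N - e (n - 2 * j - 2)%N | j <- index_iota 3 (n./2 - 1)].

Definition roots_T (k : fieldType) (n : nat) : seq 'rV[k]_n :=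
  let e := eps k n in
  [:: e (n - 3)%N - e (n - 1)%N; e (n - 2)%N + e n;
      e n - e (n - 5)%N; e (n - 3)%N - e (n - 4)%N]
  ++ [seq e (n - 2 * i)%N - e (n - 2 * i - 1)%N | i <- index_iota 3 n./2].

Definition tmap (k : fieldType) (n : nat) (g : 'rV[k]_n) : 'rV[k]_n :=
  xget 0 [set v | Qspan (roots_S k n) v /\
                  {in hLambda k n, forall H, pairing (g + v) H = 0}]%classic.

Definition Bprime (k : fieldType) (n : nat) : fchar k n :=
  \big[@fmul k n/fone k n]_(g <- roots_T k n) geom (- (g + tmap g)).

Arguments Bprime : clear implicits.

(* Main.v *)
Require Import Defs.
From mathcomp Require Import all_boot all_order all_algebra.
From mathcomp Require Import finmap.
From mathcomp Require Import all_classical.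
From mathcomp Require Import zify ring.

Set Implicit Arguments.
Unset Strict Implicit.
Unset Printing Implicit Defensive.

Import GRing.Theory.
Local Open Scope ring_scope.

(** For even n the longest element of W(D_n) is -1 and that of the subgroup
    S_n reverses the coordinates. So j is the identity, i exchanges alpha_t and
    alpha_(n-t) and fixes alpha_n, and there are n/2 + 1 orbits. As
    varpi_t - varpi'_t is a multiple of varpi_n, each delta is one: -2 varpi_n for
    t = 1, n/2, n and -4 varpi_n otherwise.

    On the other side, let x have coordinates -1, 1, ..., -1, 1 followed by
    0, 0, 1, 0, -1, 1. It is orthogonal to S and pairs to 1 with
    2 varpi_n = eps_1 + ... + eps_n; hence gamma + t(gamma) = <gamma, x> 2 varpi_n,
    and <gamma, x> is 1 for three elements of T and 2 for the other n/2 - 2.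

    All the geometric series are thus supported on the ray of multiples of
    -varpi_n, where the Cauchy product is that of power series in one variable, so
    that the order of the factors does not matter. *)

(** * Formal characters supported on a ray *)

Section FormalCharacters.
Variables (k : fieldType) (n : nat) (lam : 'rV[k]_n).
Hypothesis char0 : [pchar k] =i pred0.
Hypothesis lam_neq0 : lam != 0.

Lemma mulrn_inj_pchar0 : injective (fun m : nat => lam *+ m).
Proof.
have natk m : (m%:R == 0 :> k) = (m == 0%N) by move/pcharf0P: char0; apply.
suff W p q : (p <= q)%N -> lam *+ p = lam *+ q -> p = q.
  by move=> p q e; case/orP: (leq_total p q) => h; [|symmetry]; apply: W.
move=> le_pq e; apply/eqP; rewrite eqn_leq le_pq -subn_eq0 -natk /=.
have : lam *+ (q - p) == 0 by rewrite mulrnBr // e subrr.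
by rewrite -scaler_nat scaler_eq0 (negPf lam_neq0) orbF.
Qed.

Definition on_ray (f : fchar k n) : Prop :=
  forall mu, f mu != 0 -> exists m : nat, mu = lam *+ m.

(* A function on the ray is a power series in e^lam; [p] represents it modulo
   its N-th power. *)
Definition represents (N : nat) (f : fchar k n) (p : {poly int}) : Prop :=
  on_ray f /\ forall m, (m < N)%N -> f (lam *+ m) = p`_m.

(** The coefficient at [lam *+ m] is read off at precision [m.+1]; off the ray both functions
    vanish. *)
Lemma represents_ext (f g : fchar k n) :
  (forall N, exists2 p, represents N f p & represents N g p) -> f = g.
Proof.
move=> fg; apply/funext => mu.
have [[m ->]|nex] := pselect (exists m : nat, mu = lam *+ m).
  have [p [_ ->] // [_ ->] //] := fg m.+1.
have [p [fr _] [gr _]] := fg 0%N.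
have -> : f mu = 0 by apply/eqP; apply: contra_notT nex => /fr.
by apply/esym/eqP; apply: contra_notT nex => /gr.
Qed.

(** A nonzero term needs [nu = lam *+ i] and [lam *+ m - nu = lam *+ j]; injectivity of the
    multiples then gives [m = i + j], so the sum over all weights is finite. *)
Lemma fmul_ray (f g : fchar k n) (m : nat) : on_ray f -> on_ray g ->
  fmul f g (lam *+ m) = \sum_(i < m.+1) f (lam *+ i) * g (lam *+ (m - i)).
Proof.
move=> fr gr; rewrite /fmul.
have inj := mulrn_inj_pchar0.
have us : uniq [seq lam *+ i | i <- iota 0 m.+1] by rewrite map_inj_uniq ?iota_uniq.
rewrite (fsbigE [seq lam *+ i | i <- iota 0 m.+1]) //; last first.
  move=> nu _ nus; apply/eqP; apply: contraNT nus; rewrite mulf_eq0 negb_or.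
  case/andP => /fr [i ->] /gr [j] e; apply/mapP; exists i => //; rewrite mem_iota /= add0n ltnS.
  have: lam *+ m = lam *+ (i + j) by rewrite mulrnDr -e addrC subrK.
  by move/inj ->; rewrite leq_addr.
rewrite (eq_bigl xpredT) => [|nu]; last by exact: in_setT.
rewrite big_map -[iota 0 _]/(index_iota 0 m.+1) big_mkord; apply: eq_bigr => i _.
by rewrite mulrnBr // -ltnS.
Qed.

Lemma on_ray_fmul (f g : fchar k n) : on_ray f -> on_ray g -> on_ray (fmul f g).
Proof.
move=> fr gr mu; apply: contra_neqP => nex; apply: fsbig1 => nu _.
apply/eqP; apply: contra_notT nex; rewrite mulf_eq0 negb_or.
case/andP => /fr [i ->] /gr [j] e; exists (i + j)%N.
by rewrite mulrnDr -e addrC subrK.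
Qed.

Lemma represents_fmul N (f g : fchar k n) p q :
  represents N f p -> represents N g q -> represents N (fmul f g) (p * q).
Proof.
move=> [fr fp] [gr gq]; split; first exact: on_ray_fmul.
move=> m mN; rewrite fmul_ray // coefM; apply: eq_bigr => i _.
by rewrite fp ?gq //; apply: leq_ltn_trans mN; rewrite ?leq_subr // -ltnS.
Qed.

Lemma represents_fone N : represents N (fone k n) 1.
Proof.
rewrite /fone; split=> [mu|m _].
  by have [->|] := eqVneq mu 0 => // _; exists 0%N; rewrite mulr0n.
rewrite coef1 -(mulr0n lam); congr (_%:R).
by rewrite (inj_eq mulrn_inj_pchar0).
Qed.

(** The truncation is read off [f] itself: the rearrangements below use only the ring laws of
    [{poly int}], not a closed form of the series. *)
Definition ray_series (N : nat) (f : fchar k n) : {poly int} :=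
  \poly_(i < N) f (lam *+ i).

Lemma represents_geom N d : represents N (geom (lam *+ d)) (ray_series N (geom (lam *+ d))).
Proof.
split=> [mu|m mN]; last by rewrite coef_poly mN.
rewrite /geom; case: asboolP => // -[m ->] _.
by exists (d * m)%N; rewrite mulrnA.
Qed.

(** * Products of geometric series on the ray *)

Definition geom_prod (s : seq 'rV[k]_n) : fchar k n :=
  \big[@fmul k n/fone k n]_(v <- s) geom v.

Definition in_ray : pred 'rV[k]_n := fun v => `[< exists d : nat, v = lam *+ d >].

Lemma represents_geom_prod N s : all in_ray s ->
  represents N (geom_prod s) (\prod_(v <- s) ray_series N (geom v)).
Proof.
rewrite /geom_prod; elim: s => [_|v s IH]; first by rewrite !big_nil; exact: represents_fone.
rewrite !big_cons /= => /andP [/asboolP [d ->] /IH ?].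
by apply: represents_fmul => //; exact: represents_geom.
Qed.

(** On arbitrary functions [fmul] obeys no ring laws, so the product is carried to [{poly int}] at
    every precision and permuted there. *)
Lemma geom_prod_perm s t : all in_ray s -> perm_eq s t -> geom_prod s = geom_prod t.
Proof.
move=> rs st; apply: represents_ext => N.
exists (\prod_(v <- s) ray_series N (geom v)); first exact: represents_geom_prod.
by rewrite (perm_big _ st); apply: represents_geom_prod; rewrite -(perm_all _ st).
Qed.

Lemma geom_prod_cat s t : all in_ray s -> all in_ray t ->
  geom_prod (s ++ t) = fmul (geom_prod s) (geom_prod t).
Proof.
move=> rs rt; apply: represents_ext => N.
exists (\prod_(v <- s ++ t) ray_series N (geom v)).
  by apply: represents_geom_prod; rewrite all_cat rs.
by rewrite big_cat; apply: represents_fmul; exact: represents_geom_prod.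
Qed.

Lemma geom_prod_nseq m v : geom_prod (nseq m v) = fexp (geom v) m.
Proof. by rewrite /geom_prod /fexp; elim: m => [|m IH] /=; rewrite ?big_nil ?big_cons ?IH. Qed.

End FormalCharacters.

(** * The longest element of a reflection group *)

Section Reflections.
Variables (k : fieldType) (n : nat).
Hypothesis two_neq0 : 2 != 0 :> k.

(** All roots of D_n have squared length 2 in these coordinates, so a coroot is the transpose of its
    root. *)
Definition norm2 (b : 'rV[k]_n) : Prop := b *m b^T = 2%:M.

Lemma coroot_norm2 b : norm2 b -> coroot b = b^T.
Proof. by move=> bb; rewrite /coroot /pairing bb mxE eqxx mulr1n divff // scale1r. Qed.

Lemma norm2_reflE b : norm2 b -> refl b = 1%:M - b^T *m b.
Proof. by move=> bb; rewrite /refl coroot_norm2. Qed.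

Lemma tr_refl b : norm2 b -> (refl b)^T = refl b.
Proof. by move=> bb; rewrite norm2_reflE // linearB /= trmx1 trmx_mul trmxK. Qed.

Lemma refl_neg b : norm2 b -> b *m refl b = - b.
Proof.
move=> bb; rewrite norm2_reflE // mulmxBr mulmx1 mulmxA bb mul_scalar_mx.
by rewrite scaler_nat mulr2n opprD addrA subrr sub0r.
Qed.

Lemma refl_sqr b : norm2 b -> refl b *m refl b = 1%:M.
Proof.
move=> bb; rewrite {1}norm2_reflE // mulmxBl mul1mx -mulmxA refl_neg // mulmxN opprK.
by rewrite norm2_reflE // subrK.
Qed.

Lemma norm2_refl a b : norm2 a -> norm2 b -> norm2 (b *m refl a).
Proof.
move=> aa bb; rewrite /norm2 trmx_mul tr_refl // -mulmxA (mulmxA (refl a)).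
by rewrite refl_sqr // mul1mx.
Qed.

Lemma refl_conj a b : norm2 a -> norm2 b ->
  refl (b *m refl a) = refl a *m refl b *m refl a.
Proof.
move=> aa bb; rewrite (norm2_reflE (norm2_refl aa bb)) (norm2_reflE bb).
rewrite trmx_mul tr_refl //.
by rewrite [X in _ = X *m _]mulmxBr mulmx1 [RHS]mulmxBl refl_sqr // !mulmxA.
Qed.

End Reflections.

(** * Exchange property and uniqueness of the longest element *)

Section LongestElement.
(** [pos] abstracts the positive roots, so that the same argument serves both [simple_roots] and
    [simple_roots']. *)
Variables (k : fieldType) (n : nat) (P : seq 'rV[k]_n) (pos : 'rV[k]_n -> Prop).
Hypothesis two_neq0 : 2 != 0 :> k.
Hypothesis pos_norm : forall b, pos b -> norm2 b.
Hypothesis pos_neg : forall b, pos b -> ~ pos (- b).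
Hypothesis simple_pos : forall a, a \in P -> pos a.
Hypothesis refl_pos : forall a b, a \in P -> pos b -> b != a -> pos (b *m refl a).

Let word_prod (s : seq 'rV[k]_n) : 'M[k]_n := \big[mulmx/1%:M]_(a <- s) refl a.

(** Follow [b] through the letters of [s]. By [refl_pos] its sign can change only at a letter equal
    to the current root; deleting that letter gives [t]. *)
Lemma exchange s b : {subset s <= P} -> pos b -> pos (- (b *m word_prod s)) ->
  exists t, [/\ {subset t <= P}, size s = (size t).+1 &
                refl b *m word_prod s = word_prod t].
Proof.
elim: s b => [|c s IH] b sP pb; rewrite /word_prod ?big_nil ?mulmx1 => nb.
  by case: (pos_neg pb).
have cP : c \in P by apply: sP; rewrite mem_head.
have pc := simple_pos cP.
have sP' : {subset s <= P} by move=> x xs; apply: sP; rewrite inE xs orbT.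
rewrite big_cons in nb *.
have [eb|neq] := eqVneq b c.
  by exists s; split=> //; rewrite eb mulmxA refl_sqr ?mul1mx //; exact: pos_norm.
have pbc := refl_pos cP pb neq.
rewrite mulmxA in nb; have [t [tP st et]] := IH _ sP' pbc nb.
(* The deleted letter lies further on: [refl b *m refl c = refl c *m refl (b *m refl c)], so [c]
   stays in front. *)
exists (c :: t); split => [x||]; last 1 first.
- rewrite /word_prod in et *.
  rewrite [RHS]big_cons -et refl_conj ?mulmxA; [|exact: two_neq0|exact: pos_norm..].
  by rewrite refl_sqr ?mul1mx //; exact: pos_norm.
- by rewrite inE => /orP[/eqP -> //|/tP].
- by rewrite /= st.
Qed.

(** A letter different from the current root keeps it positive; a letter equal to it only changes
    its sign, and the induction goes on with that letter as the root. *)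
Lemma pos_word s b : {subset s <= P} -> pos b ->
  pos (b *m word_prod s) \/ pos (- (b *m word_prod s)).
Proof.
elim: s b => [|c s IH] b sP pb; rewrite /word_prod.
  by rewrite big_nil mulmx1; left.
have cP : c \in P by apply: sP; rewrite mem_head.
have sP' : {subset s <= P} by move=> x xs; apply: sP; rewrite inE xs orbT.
rewrite big_cons mulmxA; have [->|neq] := eqVneq b c; last exact: IH (refl_pos cP pb neq).
have pc := simple_pos cP; rewrite refl_neg ?mulNmx ?opprK //; last exact: pos_norm.
by case: (IH _ sP' pc); [right|left].
Qed.

Variables (w0 : 'M[k]_n) (s0 : seq 'rV[k]_n).
Hypothesis s0_word : is_word P w0 s0.
Hypothesis w0_sqr : w0 *m w0 = 1%:M.
Hypothesis w0_pos : forall b, pos b -> pos (- (b *m w0)).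

Lemma has_length_word w s : is_word P w s -> exists l, has_length P w l.
Proof.
move=> ws; have [|l /asboolP [t wt st] lmin] :=
  @ex_minnP (fun l => `[< exists2 s, is_word P w s & size s = l >]).
  by exists (size s); apply/asboolP; exists s.
exists l; split; first by exists t.
by move=> u wu; apply: lmin; apply/asboolP; exists u.
Qed.

(* A reduced word of w extends to one of w0: prepending a letter c to a reduced
   word keeps the root c positive until w0 is applied, so that the exchange
   property shortens the complementary word by one letter. *)
Lemma length_complement l0 w l : has_length P w0 l0 -> has_length P w l ->
  exists2 t, is_word P (w *m w0) t & (size t + l = l0)%N.
Proof.
move=> [[u0 [u0P eu0] su0] _]; elim: l w => [|l IH] w [[s [sP ws] ss] minw].
  exists u0; last by rewrite addn0.
  by split=> //; rewrite -eu0 ws (size0nil ss) big_nil mul1mx.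
case: s => [//|c s] in sP ws ss; case: ss => ss.
have cP : c \in P by apply: sP; rewrite mem_head.
have sP' : {subset s <= P} by move=> x xs; apply: sP; rewrite inE xs orbT.
have pc := simple_pos cP.
have lw : has_length P (word_prod s) l.
  split; first by exists s.
  move=> t [tP et]; rewrite -ltnS -[(size t).+1]/(size (c :: t)); apply: minw; split.
    by move=> x; rewrite inE => /orP[/eqP -> //|/tP].
  by rewrite ws !big_cons -/(word_prod s) et.
have [t [tP et] st] := IH _ lw.
(* If [s] made [c] negative, exchange would yield a word of [w] shorter than its length. *)
have [pcs|ncs] := pos_word sP' pc; last first.
  have [u [uP su eu]] := exchange sP' pc ncs.
  have : is_word P w u by split=> //; rewrite ws big_cons eu.
  by move/minw; rewrite -ss su ltnNge leqnSn.
(* Here [t] represents [word_prod s *m w0], which makes [c] negative, so exchange removes one letter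
   of [t]. *)
have := w0_pos pcs; rewrite -mulmxA et => nct.
have [u [uP su eu]] := exchange tP pc nct.
exists u; last by rewrite -st su addSnnS.
by split=> //; rewrite ws big_cons -mulmxA -/(word_prod s) et eu.
Qed.

(** Complementary words bound every length by that of [w0], so [w0] is longest. Any longest [w] has
    an empty complement, so [w *m w0 = 1%:M] and [w = w0]: the choice made by [xget] is forced. *)
Lemma longestE : longest P = w0.
Proof.
have [l0 lw0] := has_length_word s0_word.
have lle w l : has_length P w l -> (l <= l0)%N.
  by move=> lw; have [t _ <-] := length_complement lw0 lw; exact: leq_addl.
have w0l : is_longest P w0 by exists l0.
rewrite /longest; case: xgetP => [w _ [l lw lmax]|/(_ w0) //].
have [t [_ et] st] := length_complement lw0 lw.
have : size t = 0%N.
  by apply/eqP; rewrite -leqn0 -(leq_add2r l) st add0n; exact: lmax lw0.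
move/size0nil => t0; rewrite t0 big_nil in et.
by rewrite -[w]mulmx1 -w0_sqr mulmxA et mul1mx.
Qed.

End LongestElement.

(** * Coordinates *)

Section Pairing.
Variables (k : fieldType) (n : nat).
Implicit Types (u v : 'rV[k]_n) (H : 'cV[k]_n).
Notation e := (eps k n).

Lemma pairingD u v H : pairing (u + v) H = pairing u H + pairing v H.
Proof. by rewrite /pairing mulmxDl mxE. Qed.

Lemma pairingN v H : pairing (- v) H = - pairing v H.
Proof. by rewrite /pairing mulNmx mxE. Qed.

Lemma pairingB u v H : pairing (u - v) H = pairing u H - pairing v H.
Proof. by rewrite pairingD pairingN. Qed.

Lemma pairingZ c v H : pairing (c *: v) H = c * pairing v H.
Proof. by rewrite /pairing -scalemxAl mxE. Qed.

Lemma pairing_sum (I : Type) (r : seq I) (F : I -> 'rV[k]_n) H :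
  pairing (\sum_(i <- r) F i) H = \sum_(i <- r) pairing (F i) H.
Proof. by rewrite /pairing mulmx_suml summxE. Qed.

Lemma pairingDr v (H1 H2 : 'cV[k]_n) : pairing v (H1 + H2) = pairing v H1 + pairing v H2.
Proof. by rewrite /pairing mulmxDr mxE. Qed.

Lemma pairingZr c v H : pairing v (c *: H) = c * pairing v H.
Proof. by rewrite /pairing -scalemxAr mxE. Qed.

(** The function takes 1-based indices, in agreement with [eps]. *)
Definition fcol (f : nat -> k) : 'cV[k]_n := \col_(j < n) f j.+1.

Lemma pairing_eps f i : (0 < i <= n)%N -> pairing (e i) (fcol f) = f i.
Proof.
case: i => // i /= ltin; rewrite /pairing mxE (bigD1 (Ordinal ltin)) //= !mxE eqxx mul1r.
rewrite big1 ?addr0 // => j; rewrite -val_eqE /= => /negPf ne.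
by rewrite !mxE eqSS ne mul0r.
Qed.

Lemma tr_eps i : (e i)^T = fcol (fun j => (j == i)%:R).
Proof. by apply/colP => j; rewrite !mxE. Qed.

(** A coordinate written as a pairing, so that the linearity lemmas for [pairing] apply to it. *)
Definition xcoord v i : k := pairing v (e i)^T.

Lemma xcoordE v (j : 'I_n) : xcoord v j.+1 = v 0 j.
Proof.
rewrite /xcoord /pairing mxE (bigD1 j) //= !mxE eqxx mulr1.
rewrite big1 ?addr0 // => l; rewrite -val_eqE /= => /negPf ne.
by rewrite !mxE eqSS ne mulr0.
Qed.

Lemma xcoordP u v : (forall i, (0 < i <= n)%N -> xcoord u i = xcoord v i) -> u = v.
Proof. by move=> uv; apply/rowP => j; rewrite -!xcoordE uv /=. Qed.

Lemma xcoord_eps i j : (0 < i <= n)%N -> xcoord (e i) j = (i == j)%:R.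
Proof. by move=> hi; rewrite /xcoord tr_eps pairing_eps. Qed.

Lemma row_eps_sum v : v = \sum_(1 <= i < n.+1) xcoord v i *: e i.
Proof.
apply: xcoordP => i hi; rewrite /xcoord pairing_sum.
rewrite (bigD1_seq i) ?iota_uniq ?mem_index_iota //= pairingZ.
rewrite -/(xcoord (e i) i) xcoord_eps // eqxx mulr1 big_nat_cond big1 ?addr0 //.
move=> j /andP [hj /negPf ne].
by rewrite pairingZ -/(xcoord (e j) i) xcoord_eps ?ne ?mulr0 // -ltnS.
Qed.

Lemma eps_mulmxP (A B : 'M[k]_n) :
  (forall i, (0 < i <= n)%N -> e i *m A = e i *m B) -> A = B.
Proof.
move=> AB; apply/row_matrixP => j; rewrite !rowE.
suff -> : delta_mx 0 j = e j.+1 by apply: AB => /=.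
by apply/rowP => l; rewrite !mxE.
Qed.

(* The root e_i - e_j for s = true, e_i + e_j for s = false. *)
Definition droot (i j : nat) (s : bool) : 'rV[k]_n := e i + (-1) ^+ s *: e j.

Lemma droot_sub i j : droot i j true = e i - e j.
Proof. by rewrite /droot expr1 scaleN1r. Qed.

Lemma droot_add i j : droot i j false = e i + e j.
Proof. by rewrite /droot expr0 scale1r. Qed.

Lemma dot_eps i j : (0 < i <= n)%N -> e i *m (e j)^T = ((i == j)%:R)%:M.
Proof. by move=> hi; rewrite [LHS]mx11_scalar -xcoord_eps. Qed.

Lemma norm2_droot i j s : (0 < i < j)%N -> (j <= n)%N -> norm2 (droot i j s).
Proof.
move=> /andP [i0 ij] jn; have [hi hj] : (0 < i <= n)%N /\ (0 < j <= n)%N by lia.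
rewrite /norm2 /droot linearD linearZ /= mulmxDl !mulmxDr -!scalemxAl -!scalemxAr.
rewrite !dot_eps // !eqxx scalerA -expr2 sqrr_sign scale1r.
have -> : (i == j) = false by lia.
have -> : (j == i) = false by lia.
by rewrite mulr0n raddf0 !scaler0 addr0 add0r -raddfD.
Qed.

Hypothesis two_neq0 : 2 != 0 :> k.

Lemma eps_refl i j s l : (0 < i < j)%N -> (j <= n)%N -> (0 < l <= n)%N ->
  e l *m refl (droot i j s) =
    if l == i then - ((-1) ^+ s *: e j)
    else if l == j then - ((-1) ^+ s *: e i) else e l.
Proof.
move=> hij jn hl; rewrite norm2_reflE //; last exact: norm2_droot.
have lD : e l *m (droot i j s)^T = ((l == i)%:R + (-1) ^+ s * (l == j)%:R)%:M.
  by rewrite linearD linearZ /= mulmxDr -scalemxAr !dot_eps // scale_scalar_mx raddfD.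
rewrite mulmxBr mulmx1 mulmxA lD mul_scalar_mx /droot.
case: eqP => [->|_]; case: eqP => [?|_]; try lia.
- by rewrite mulr0 addr0 scale1r opprD addrA subrr sub0r.
- rewrite add0r mulr1 scalerDr scalerA -expr2 sqrr_sign scale1r => //.
  by subst l; rewrite opprD addrCA subrr addr0.
- by rewrite mulr0 addr0 scale0r subr0.
Qed.

Lemma eps_refl_sub i j l : (0 < i < j)%N -> (j <= n)%N -> (0 < l <= n)%N ->
  e l *m refl (e i - e j) = e (if l == i then j else if l == j then i else l).
Proof.
move=> hij jn hl; rewrite -droot_sub eps_refl // expr1 !scaleN1r !opprK.
by case: ifP => // _; case: ifP.
Qed.

Lemma eps_refl_add i j l : (0 < i < j)%N -> (j <= n)%N -> (0 < l <= n)%N ->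
  e l *m refl (e i + e j) =
    if l == i then - e j else if l == j then - e i else e l.
Proof. by move=> hij jn hl; rewrite -droot_add eps_refl // expr0 !scale1r. Qed.

End Pairing.

(** * The longest elements in types D and A *)

Section WeylGroups.
Variables (k : fieldType) (n : nat).
Hypothesis char0 : [pchar k] =i pred0.
Notation e := (eps k n).
Notation simple := (simple k n).
Notation P := (simple_roots k n).
Notation P' := (simple_roots' k n).

Lemma natr_eq0_char0 m : (m%:R == 0 :> k) = (m == 0%N).
Proof. by move/pcharf0P: char0; apply. Qed.

Lemma two_neq0 : 2 != 0 :> k.
Proof. by rewrite natr_eq0_char0. Qed.

Lemma simple_lt i : (i < n)%N -> simple i = e i - e i.+1.
Proof. by rewrite /Defs.simple => ->. Qed.

Lemma simple_last : simple n = e n.-1 + e n.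
Proof. by rewrite /Defs.simple ltnn. Qed.

Lemma simple_rootsP a : reflect (exists2 i, (0 < i <= n)%N & a = simple i) (a \in P).
Proof.
apply: (iffP mapP) => -[i hi ->]; exists i => //; rewrite mem_index_iota in hi *; lia.
Qed.

Lemma simple_roots'P a : reflect (exists2 i, (0 < i < n)%N & a = simple i) (a \in P').
Proof. by apply: (iffP mapP) => -[i hi ->]; exists i => //; rewrite mem_index_iota in hi *. Qed.

Definition posD (b : 'rV[k]_n) : Prop :=
  exists i j s, [/\ (0 < i < j)%N, (j <= n)%N & b = droot k n i j s].

Definition posA (b : 'rV[k]_n) : Prop :=
  exists i j, [/\ (0 < i < j)%N, (j <= n)%N & b = e i - e j].

Lemma posA_posD b : posA b -> posD b.
Proof. by move=> [i [j [hij jn ->]]]; exists i, j, true; rewrite droot_sub. Qed.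

Lemma posD_norm2 b : posD b -> norm2 b.
Proof. by move=> [i [j [s [hij jn ->]]]]; apply: norm2_droot. Qed.

Lemma posD_neg b : posD b -> ~ posD (- b).
Proof.
(* The coordinates of the half sum of positive roots: [H] measures height, namely j - i on e_i - e_j
   and 2n - i - j on e_i + e_j, both positive. *)
pose H := fcol n (fun i => (n - i)%:R : k).
have ht c : posD c -> exists m, pairing c H = m.+1%:R.
  move=> [i [j [s [hij jn ->]]]]; rewrite /droot pairingD pairingZ !pairing_eps; try lia.
  case: s; rewrite ?expr1 ?expr0 ?mulN1r ?mul1r.
    by exists (j - i).-1; rewrite -natrB; [congr _%:R; lia|lia].
  by exists (n - i + (n - j)).-1; rewrite -natrD; congr _%:R; lia.
move=> /ht [p ep] /ht [q]; rewrite pairingN ep => /eqP.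
by rewrite eq_sym -addr_eq0 -natrD natr_eq0_char0 addnS.
Qed.

Lemma simple'_posA a : a \in P' -> posA a.
Proof.
by case/simple_roots'P => i hi ->; exists i, i.+1; rewrite simple_lt; [split=> //; lia|lia].
Qed.

Hypothesis n_ge2 : (2 <= n)%N.

Lemma simple_posD a : a \in P -> posD a.
Proof.
case/simple_rootsP => i hi ->; have [lt_in|ge_in] := ltnP i n.
  by apply: posA_posD; apply: simple'_posA; apply/simple_roots'P; exists i; [lia|].
have -> : i = n by lia.
by exists n.-1, n, false; rewrite simple_last droot_add; split=> //; lia.
Qed.

Lemma droot_refl_simple p i j s : (0 < p < n)%N -> (0 < i < j)%N -> (j <= n)%N ->
  droot k n i j s *m refl (e p - e p.+1) =
  droot k n (if i == p then p.+1 else if i == p.+1 then p else i)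
        (if j == p then p.+1 else if j == p.+1 then p else j) s.
Proof.
move=> hp hij jn; rewrite /droot mulmxDl -scalemxAl !eps_refl_sub //; try lia; exact: two_neq0.
Qed.

(** Exchanging the adjacent indices p and p+1 reverses the order of i < j only for the pair (p, p+1)
    itself. *)
Lemma refl_posA a b : a \in P' -> posA b -> b != a -> posA (b *m refl a).
Proof.
case/simple_roots'P => p hp -> [i [j [hij jn ->]]]; rewrite simple_lt; last lia.
rewrite -(droot_sub k n i j) droot_refl_simple // !droot_sub => ne.
have ne' : ~ (i = p /\ j = p.+1) by case=> ? ?; subst; rewrite eqxx in ne.
by do 2 eexists; split; last reflexivity; repeat case: eqP => ?; lia.
Qed.

Lemma refl_posD a b : a \in P -> posD b -> b != a -> posD (b *m refl a).
Proof.
case/simple_rootsP => p hp -> [i [j [s [hij jn ->]]]].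
have [lt_pn|ge_pn] := ltnP p n.
  rewrite simple_lt // droot_refl_simple //; try lia.
  move=> ne; have [ip|nip] := eqVneq i p; last first.
    by do 3 eexists; split; last reflexivity; repeat case: eqP => ?; lia.
  have [jp|njp] := eqVneq j p.+1; last first.
    by do 3 eexists; split; last reflexivity; repeat case: eqP => ?; lia.
  have -> : (j == p) = false by lia.
  (* For the pair (p, p+1) only e_p + e_(p+1) remains, and it is fixed by the exchange. *)
  case: s ne => ne; first by rewrite ip jp droot_sub eqxx in ne.
  by exists p, p.+1, false; rewrite !droot_add addrC; split=> //; lia.
(* The last reflection sends e_(n-1) to -e_n and e_n to -e_(n-1). For i < n-1 this turns e_i ±
   e_(n-1) into e_i ∓ e_n and conversely; e_(n-1) - e_n is fixed. *)
have -> : p = n by lia.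
rewrite simple_last /droot mulmxDl -scalemxAl !eps_refl_add //; try lia; try exact: two_neq0.
have -> : (i == n) = false by lia.
move=> ne; have [ip|nip] := eqVneq i n.-1.
  have -> : (j == n.-1) = false by lia.
  have jn' : j = n by lia.
  rewrite jn' eqxx; case: s ne; rewrite ?expr1 ?expr0 ?scale1r ?scaleN1r ?opprK => ne.
    by exists n.-1, n, true; rewrite droot_sub addrC; split=> //; lia.
  by rewrite ip ?jn' eqxx in ne.
have [jp|njp] := eqVneq j n.-1.
  by exists i, n, (~~ s); rewrite /droot signrN scaleNr scalerN; split=> //; lia.
have [jn'|njn] := eqVneq j n.
  by exists i, n.-1, (~~ s); rewrite /droot signrN scaleNr scalerN; split=> //; lia.
by exists i, j, s; split.
Qed.

(** * Longest elements as words in simple reflections *)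

Definition in_weyl (Q : seq 'rV[k]_n) (w : 'M[k]_n) : Prop := exists s, is_word Q w s.

Lemma in_weylM Q v w : in_weyl Q v -> in_weyl Q w -> in_weyl Q (v *m w).
Proof.
move=> [s [sQ ->]] [t [tQ ->]]; exists (s ++ t); split.
  by move=> x; rewrite mem_cat => /orP[/sQ|/tQ].
by elim: (s) => [|a u IH] /=; rewrite ?big_nil ?mul1mx // !big_cons -IH mulmxA.
Qed.

Lemma in_weyl_refl Q a : a \in Q -> in_weyl Q (refl a).
Proof.
move=> aQ; exists [:: a]; split; last by rewrite big_cons big_nil mulmx1.
by move=> x; rewrite inE => /eqP ->.
Qed.

Lemma in_weyl1 Q : in_weyl Q 1%:M.
Proof. by exists [::]; split; rewrite ?big_nil. Qed.

Lemma in_weyl_conj Q a b : norm2 a -> norm2 b ->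
  in_weyl Q (refl a) -> in_weyl Q (refl b) -> in_weyl Q (refl (b *m refl a)).
Proof.
by move=> aa bb wa wb; rewrite refl_conj //; [do 2?apply: in_weylM|exact: two_neq0].
Qed.

(** Induction on j: the simple reflection exchanging j and j+1 carries e_i - e_j to e_i - e_(j+1),
    and the reflections are conjugate. *)
Lemma in_weyl_sub Q i j : {subset P' <= Q} -> (0 < i < j)%N -> (j <= n)%N ->
  in_weyl Q (refl (e i - e j)).
Proof.
move=> PQ; elim: j => [|j IH] hij jn; first by lia.
have simpleQ : (0 < j)%N -> in_weyl Q (refl (e j - e j.+1)).
  move=> j0; rewrite -simple_lt //; apply: in_weyl_refl; apply: PQ.
  by apply/simple_roots'P; exists j => //; lia.
have [->|ne] := eqVneq i j; first by apply: simpleQ; lia.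
suff -> : e i - e j.+1 = (e i - e j) *m refl (e j - e j.+1).
  apply: in_weyl_conj; [| |by apply: simpleQ; lia|by apply: IH; lia].
  - by rewrite -droot_sub; apply: norm2_droot; lia.
  - by rewrite -droot_sub; apply: norm2_droot; lia.
rewrite mulmxBl !eps_refl_sub //; try lia; try exact: two_neq0.
by rewrite eqxx (negPf ne); have -> : (i == j.+1) = false by lia.
Qed.

(** Conjugation starting from the simple root e_(n-1) + e_n: first the index n-1 is moved to any l,
    then n is moved to j. *)
Lemma in_weyl_add i j : (0 < i < j)%N -> (j <= n)%N -> in_weyl P (refl (e i + e j)).
Proof.
have P'P : {subset P' <= P}.
  by move=> a /simple_roots'P [p hp ->]; apply/simple_rootsP; exists p => //; lia.
have addn l : (0 < l < n)%N -> in_weyl P (refl (e l + e n)).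
  move=> hl; have wl : in_weyl P (refl (e n.-1 + e n)).
    by rewrite -simple_last; apply: in_weyl_refl; apply/simple_rootsP; exists n => //; lia.
  have [->//|ne] := eqVneq l n.-1.
  suff -> : e l + e n = (e n.-1 + e n) *m refl (e l - e n.-1).
    apply: in_weyl_conj => //; last by apply: in_weyl_sub => //; lia.
    - by rewrite -droot_sub; apply: norm2_droot; lia.
    - by rewrite -droot_add; apply: norm2_droot; lia.
  rewrite mulmxDl !eps_refl_sub //; try lia; try exact: two_neq0.
  have -> : (n.-1 == l) = false by lia.
  have -> : (n == l) = false by lia.
  have -> : (n == n.-1) = false by lia.
  by rewrite eqxx.
move=> hij jn; have [->|ne] := eqVneq j n; first by apply: addn; lia.
suff -> : e i + e j = (e i + e n) *m refl (e j - e n).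
  apply: in_weyl_conj; [| |by apply: in_weyl_sub => //; lia|by apply: addn; lia].
  - by rewrite -droot_sub; apply: norm2_droot; lia.
  - by rewrite -droot_add; apply: norm2_droot; lia.
rewrite mulmxDl !eps_refl_sub //; try lia; try exact: two_neq0.
have -> : (i == j) = false by lia.
have -> : (i == n) = false by lia.
have -> : (n == j) = false by lia.
by rewrite eqxx.
Qed.

Hypothesis n_even : ~~ odd n.

(** The reflections in e_a - e_b and e_a + e_b together negate the coordinates a and b. As n is
    even, the pairs (1,2), (3,4), ... exhaust all coordinates. *)
Lemma in_weyl_opp : in_weyl P (- 1%:M).
Proof.
have P'P : {subset P' <= P}.
  by move=> a /simple_roots'P [p hp ->]; apply/simple_rootsP; exists p => //; lia.
suff W m : (m.*2 <= n)%N -> exists2 w, in_weyl P w &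
    forall i, (0 < i <= n)%N -> e i *m w = if (i <= m.*2)%N then - e i else e i.
  have [w ww ew] := W n./2 ltac:(lia).
  suff <- : w = - 1%:M by [].
  by apply: eps_mulmxP => i hi; rewrite ew // mulmxN mulmx1 ifT //; lia.
elim: m => [|m IH] hm.
  by exists 1%:M => [|i hi]; [exact: in_weyl1|rewrite mulmx1 ifF //; lia].
have [w ww ew] := IH ltac:(lia).
exists (w *m (refl (e m.*2.+1 - e m.*2.+2) *m refl (e m.*2.+1 + e m.*2.+2))).
  by apply: in_weylM => //; apply: in_weylM; [apply: in_weyl_sub|apply: in_weyl_add] => //; lia.
have t0 := two_neq0.
move=> i hi; rewrite mulmxA ew //.
have [le|gt] := leqP i m.*2.
  rewrite ifT; last lia.
  rewrite mulmxA mulNmx eps_refl_sub //; try lia.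
  rewrite !ifF ?mulNmx ?eps_refl_add //; try lia.
  by rewrite !ifF //; lia.
rewrite mulmxA eps_refl_sub //; try lia.
have [->|n1] := eqVneq i m.*2.+1.
  rewrite eps_refl_add //; try lia.
  by rewrite ifF ?eqxx ?ifT //; lia.
have [->|n2] := eqVneq i m.*2.+2.
  by rewrite eps_refl_add //; try lia; rewrite eqxx ifT //; lia.
by rewrite eps_refl_add //; try lia; rewrite !ifF //; lia.
Qed.

Lemma longest_D : longest P = - 1%:M.
Proof.
have [s sw] := in_weyl_opp.
apply: (longestE two_neq0 posD_norm2 posD_neg simple_posD refl_posD sw).
  by rewrite mulmxN mulNmx opprK mulmx1.
by move=> b pb; rewrite mulmxN mulmx1 opprK.
Qed.

(** The reversal is the product of the transpositions of m+1 and n-m for m < n/2. *)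
Lemma in_weyl_rev : exists2 w, in_weyl P' w &
  forall i, (0 < i <= n)%N -> e i *m w = e (n.+1 - i)%N.
Proof.
suff W m : (m.*2 <= n)%N -> exists2 w, in_weyl P' w &
    forall i, (0 < i <= n)%N ->
      e i *m w = if (i <= m)%N || (n - m < i)%N then e (n.+1 - i)%N else e i.
  have [w ww ew] := W n./2 ltac:(lia).
  by exists w => // i hi; rewrite ew // ifT //; lia.
elim: m => [|m IH] hm.
  by exists 1%:M => [|i hi]; [exact: in_weyl1|rewrite mulmx1 ifF //; lia].
have [w ww ew] := IH ltac:(lia).
exists (w *m refl (e m.+1 - e (n - m)%N)).
  by apply: in_weylM => //; apply: in_weyl_sub => //; lia.
have t0 := two_neq0.
move=> i hi; rewrite mulmxA ew //.
case: ifP => c1; rewrite eps_refl_sub //; try lia.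
  all: by repeat case: ifP => ?; congr e; lia.
Qed.

Lemma longest_A i : (0 < i <= n)%N -> e i *m longest P' = e (n.+1 - i)%N.
Proof.
have [w [s sw] ew] := in_weyl_rev.
suff -> : longest P' = w by exact: ew.
apply: (longestE two_neq0 _ _ simple'_posA refl_posA sw).
- by move=> b /posA_posD; exact: posD_norm2.
- by move=> b /posA_posD pb /posA_posD; exact: posD_neg.
- apply: eps_mulmxP => l hl; rewrite mulmxA !ew ?mulmx1; try lia.
  by congr e; lia.
- move=> b [l [j [hlj jn ->]]]; exists (n.+1 - j)%N, (n.+1 - l)%N.
  by rewrite mulmxBl !ew ?opprB; [split=> //; lia|lia|lia].
Qed.

End WeylGroups.

(** * Rational spans in characteristic zero *)

Section RationalSpan.
Variable k : fieldType.
Hypothesis char0 : [pchar k] =i pred0.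

Lemma intr_eq0_char0 (z : int) : (z%:~R == 0 :> k) = (z == 0).
Proof.
case: z => m; first exact: natr_eq0_char0.
by rewrite NegzE mulrNz oppr_eq0 natr_eq0_char0.
Qed.

(** [ratr] is defined by the reduced fraction; cross multiplication in the integers compares it with
    any other, since nonzero denominators stay nonzero in [k]. Additivity and multiplicativity of
    [ratr] follow. *)
Lemma ratr_frac (a b : int) : b != 0 -> ratr (a%:~R / b%:~R) = a%:~R / b%:~R :> k.
Proof.
move=> b0; set x := a%:~R / b%:~R; have d0 := denq_neq0 x.
have bq : b%:~R != 0 :> rat by rewrite intr_eq0.
have dq : (denq x)%:~R != 0 :> rat by rewrite intr_eq0.
have e : a * denq x = numq x * b.
  have: (a * denq x)%:~R = (numq x * b)%:~R :> rat.
    rewrite !intrM -[X in _ * X = _]mulr1 -{2}(divff bq).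
    rewrite numqE /x; field.
    exact: bq.
  by move/intr_inj.
apply/eqP; rewrite /ratr eqr_div ?intr_eq0_char0 //.
by rewrite -!intrM e.
Qed.

Definition is_rat (c : k) : Prop := exists q : rat, c = ratr q.

Lemma ratrD p q : ratr (p + q) = ratr p + ratr q :> k.
Proof.
have pd := denq_neq0 p; have qd := denq_neq0 q.
have -> : p + q = (numq p * denq q + numq q * denq p)%:~R / (denq p * denq q)%:~R.
  by rewrite -{1}(divq_num_den p) -{1}(divq_num_den q) addf_div ?intr_eq0 // -!intrM -!intrD.
rewrite ratr_frac ?mulf_neq0 // /ratr addf_div ?intr_eq0_char0 //.
by rewrite -!intrM -!intrD.
Qed.

Lemma ratrM p q : ratr (p * q) = ratr p * ratr q :> k.
Proof.
have pd := denq_neq0 p; have qd := denq_neq0 q.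
have -> : p * q = (numq p * numq q)%:~R / (denq p * denq q)%:~R.
  by rewrite -{1}(divq_num_den p) -{1}(divq_num_den q) mulf_div -!intrM.
by rewrite ratr_frac ?mulf_neq0 // /ratr mulf_div -!intrM.
Qed.

Lemma is_ratD c d : is_rat c -> is_rat d -> is_rat (c + d).
Proof. by move=> [p ->] [q ->]; exists (p + q); rewrite ratrD. Qed.

Lemma is_ratM c d : is_rat c -> is_rat d -> is_rat (c * d).
Proof. by move=> [p ->] [q ->]; exists (p * q); rewrite ratrM. Qed.

Lemma is_rat_nat m : is_rat m%:R.
Proof. by exists m%:R; rewrite ratr_nat. Qed.

Lemma is_ratN c : is_rat c -> is_rat (- c).
Proof.
move=> hc; rewrite -mulN1r; apply: is_ratM => //.
by exists (- 1)%:~R; rewrite ratr_int.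
Qed.

Lemma is_ratV m : is_rat (m%:R^-1).
Proof.
have [->|m0] := eqVneq m 0%N; first by rewrite invr0; exact: (is_rat_nat 0).
exists (1%:~R / (Posz m)%:~R); rewrite ratr_frac ?div1r //.
Qed.

Variable n : nat.
Implicit Types (v : 'rV[k]_n) (Q : seq 'rV[k]_n).

Lemma QspanD Q u v : Qspan Q u -> Qspan Q v -> Qspan Q (u + v).
Proof.
move=> [c ->] [d ->]; exists (fun x => c x + d x); rewrite -big_split.
by apply: eq_bigr => x _; rewrite ratrD scalerDl.
Qed.

Lemma QspanZ Q a v : is_rat a -> Qspan Q v -> Qspan Q (a *: v).
Proof.
move=> [q ->] [c ->]; exists (fun x => q * c x); rewrite scaler_sumr.
by apply: eq_bigr => x _; rewrite ratrM scalerA.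
Qed.

Lemma QspanN Q v : Qspan Q v -> Qspan Q (- v).
Proof. by rewrite -scaleN1r; apply: QspanZ; apply: is_ratN; exact: (is_rat_nat 1). Qed.

Lemma QspanB Q u v : Qspan Q u -> Qspan Q v -> Qspan Q (u - v).
Proof. by move=> Qu /QspanN; exact: QspanD. Qed.

Lemma Qspan0 Q : Qspan Q 0.
Proof.
exists (fun=> 0); rewrite big1 // => x _.
by rewrite (ratr_nat _ 0) scale0r.
Qed.

Lemma Qspan_sum Q (I : eqType) (r : seq I) (F : I -> 'rV[k]_n) :
  {in r, forall i, Qspan Q (F i)} -> Qspan Q (\sum_(i <- r) F i).
Proof.
elim: r => [|i r IH] h; first by rewrite big_nil; exact: Qspan0.
rewrite big_cons; apply: QspanD; first by apply: h; rewrite mem_head.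
by apply: IH => j jr; apply: h; rewrite inE jr orbT.
Qed.

(** The sum in [Qspan] counts repetitions in [Q], so the coefficient of [v] is the inverse of its
    multiplicity. *)
Lemma Qspan_mem Q v : v \in Q -> Qspan Q v.
Proof.
move=> vQ; have m0 : (count_mem v Q)%:R != 0 :> k.
  by rewrite natr_eq0_char0 // -lt0n -has_count has_pred1.
have [q qE] := is_ratV (count_mem v Q).
exists (fun u => if u == v then q else 0).
rewrite (eq_bigr (fun u => if u == v then ratr q *: v else 0)); last first.
  by move=> u _; case: eqP => [->//|_]; rewrite (ratr_nat _ 0) scale0r.
rewrite -big_mkcond big_const_seq iter_addr_0 -qE -scaler_nat scalerA.
by rewrite divff // scale1r.
Qed.

Lemma pairing_Qspan Q v (H : 'cV[k]_n) : Qspan Q v ->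
  {in Q, forall a, pairing a H = 0} -> pairing v H = 0.
Proof.
move=> [c ->] QH; rewrite pairing_sum big_seq big1 // => a aQ.
by rewrite pairingZ QH // mulr0.
Qed.

End RationalSpan.

(** * Fundamental weights *)

Section FundamentalWeights.
Variables (k : fieldType) (n : nat).
Hypothesis char0 : [pchar k] =i pred0.
Hypothesis n_ge2 : (2 <= n)%N.
Notation e := (eps k n).
Notation simple := (simple k n).
Notation P := (simple_roots k n).
Notation P' := (simple_roots' k n).

Definition frow (f : nat -> k) : 'rV[k]_n := (fcol n f)^T.

Lemma xcoord_frow f i : (0 < i <= n)%N -> xcoord (frow f) i = f i.
Proof. by case: i => // i /= hi; rewrite (xcoordE _ (Ordinal hi)) !mxE. Qed.

(** This is twice the last fundamental weight. *)
Definition ones : 'rV[k]_n := frow (fun=> 1).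

Lemma coroot_simple_lt v i : (0 < i < n)%N ->
  pairing v (coroot (simple i)) = xcoord v i - xcoord v i.+1.
Proof.
move=> hi; rewrite coroot_norm2; last 2 first.
- exact: two_neq0.
- by apply: posD_norm2; apply: simple_posD => //; apply/simple_rootsP; exists i => //; lia.
rewrite simple_lt; last lia.
by rewrite linearB /= -scaleN1r pairingDr pairingZr mulN1r.
Qed.

Lemma coroot_simple_last v :
  pairing v (coroot (simple n)) = xcoord v n.-1 + xcoord v n.
Proof.
rewrite coroot_norm2; last 2 first.
- exact: two_neq0.
- by apply: posD_norm2; apply: simple_posD => //; apply/simple_rootsP; exists n => //; lia.
by rewrite simple_last linearD /= pairingDr.
Qed.

(** The j-th coordinate of varpi_i: e_1 + ... + e_i for i <= n-2, and the half-spin weights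
    (1,...,1,-1)/2 and (1,...,1)/2 for i = n-1 and n. *)
Definition fund_coefD (i j : nat) : k :=
  if i == n then 2%:R^-1 else if i == n.-1 then 2%:R^-1 - (j == n)%:R
  else (j <= i)%:R.

Lemma half_half : 2%:R^-1 + 2%:R^-1 = 1 :> k.
Proof. by have t0 := two_neq0 char0; field. Qed.

Lemma fund_coefD_lt i j : (0 < i <= n)%N -> (0 < j < n)%N ->
  fund_coefD i j - fund_coefD i j.+1 = (j == i)%:R.
Proof.
move=> hi hj; rewrite /fund_coefD; case: eqP => [->|ne].
  by rewrite subrr; have -> : (j == n) = false by lia.
case: eqP => [->|ne1].
  have -> : (j == n) = false by lia.
  have -> : (j.+1 == n) = (j == n.-1) by lia.
  by rewrite subr0 opprB addrC subrK.
have [lt|gt|eq] := ltngtP j i; rewrite /= ?subrr //.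
by rewrite subr0.
Qed.

Lemma fund_coefD_last i : (0 < i <= n)%N -> fund_coefD i n.-1 + fund_coefD i n = (n == i)%:R.
Proof.
move=> hi; rewrite /fund_coefD; case: eqP => [->|ne]; first by rewrite half_half eqxx.
have -> : (n == i) = false by lia.
have -> : (n.-1 == n) = false by lia.
case: eqP => [_|ne1]; first by rewrite eqxx subr0 addrA half_half subrr.
have -> : (n.-1 <= i)%N = false by lia.
have -> : (n <= i)%N = false by lia.
by rewrite addr0.
Qed.

Lemma simple_inj i j : (0 < i <= n)%N -> (0 < j <= n)%N ->
  (simple j == simple i) = (j == i).
Proof.
move=> hi hj; apply/eqP/eqP => [|-> //].
(* The i-th fundamental weight, used as a column, separates the i-th simple root from the others. *)
have pS l : (0 < l <= n)%N -> pairing (simple l) (fcol n (fund_coefD i)) = (l == i)%:R.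
  move=> hl; have [ltl|gel] := ltnP l n.
    by rewrite simple_lt // pairingB !pairing_eps ?fund_coefD_lt //; lia.
  have -> : l = n by lia.
  by rewrite simple_last pairingD !pairing_eps ?fund_coefD_last //; lia.
move=> /(congr1 (fun a => pairing a (fcol n (fund_coefD i)))); rewrite !pS // eqxx.
by have [//|_ /eqP] := eqVneq j i; rewrite eq_sym oner_eq0.
Qed.

(** e_n is half of alpha_n - alpha_(n-1); adding alpha_(n-1), alpha_(n-2), ... then yields the other
    e_i. *)
Lemma Qspan_eps i : (0 < i <= n)%N -> Qspan P (e i).
Proof.
have Ps l : (0 < l <= n)%N -> Qspan P (simple l).
  by move=> hl; apply: Qspan_mem => //; apply/simple_rootsP; exists l.
have En : Qspan P (e n).
  have -> : e n = 2%:R^-1 *: (simple n - simple n.-1).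
    rewrite simple_last simple_lt ?prednK; try lia.
    rewrite opprB addrC addrA subrK -mulr2n -scaler_nat scalerA.
    by rewrite mulVf ?scale1r //; exact: two_neq0.
  by apply: QspanZ => //; [exact: is_ratV|apply: QspanB => //; apply: Ps; lia].
suff W m : (m < n)%N -> Qspan P (e (n - m)).
  by move=> hi; rewrite (_ : i = n - (n - i))%N; [apply: W|]; lia.
elim: m => [|m IH] hm; first by rewrite subn0.
have -> : e (n - m.+1) = simple (n - m.+1) + e (n - m).
  rewrite simple_lt; last lia.
  by rewrite (_ : (n - m.+1).+1 = n - m)%N ?subrK //; lia.
by apply: QspanD => //; [apply: Ps; lia|apply: IH; lia].
Qed.

Lemma Qspan_eps_sub i j : (0 < i <= j)%N -> (j <= n)%N -> Qspan P' (e i - e j).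
Proof.
elim: j => [|j IH] hij jn; first lia.
have [->|ne] := eqVneq i j.+1; first by rewrite subrr; exact: Qspan0.
rewrite -(subrK (e j) (e i)) -addrA; apply: QspanD => //; first by apply: IH; lia.
rewrite -simple_lt //; apply: Qspan_mem => //; apply/simple_roots'P.
by exists j => //; lia.
Qed.

Lemma frow_sum f : frow f = \sum_(1 <= i < n.+1) f i *: e i.
Proof.
rewrite [LHS]row_eps_sum; apply: eq_big_nat => i hi.
by rewrite xcoord_frow // -ltnS.
Qed.

Lemma Qspan_frow f : (forall i, is_rat (f i)) -> Qspan P (frow f).
Proof.
move=> fr; rewrite frow_sum; apply: Qspan_sum => // i; rewrite mem_index_iota => hi.
by apply: QspanZ => //; apply: Qspan_eps; lia.
Qed.

Lemma Qspan_frow' f : (forall i, is_rat (f i)) ->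
  \sum_(1 <= i < n.+1) f i = 0 -> Qspan P' (frow f).
Proof.
(* The coefficients sum to zero, so subtracting e_n from every e_i changes nothing. *)
move=> fr f0; have -> : frow f = \sum_(1 <= i < n.+1) f i *: (e i - e n).
  rewrite frow_sum; under [RHS]eq_bigr do rewrite scalerBr.
  by rewrite sumrB -scaler_suml f0 scale0r subr0.
apply: Qspan_sum => // i; rewrite mem_index_iota => hi.
by apply: QspanZ => //; apply: Qspan_eps_sub; lia.
Qed.

Lemma pairing_frow f (H : nat -> k) :
  pairing (frow f) (fcol n H) = \sum_(1 <= i < n.+1) f i * H i.
Proof.
rewrite frow_sum pairing_sum; apply: eq_big_nat => i hi.
by rewrite pairingZ pairing_eps // -ltnS.
Qed.

(** Vectors that agree on the coroots of pi' differ by a multiple of [ones]. All uniqueness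
    arguments for weights below start from this. *)
Lemma eq_simple_differences (u v : 'rV[k]_n) i j :
  (forall l, (0 < l < n)%N -> xcoord u l - xcoord u l.+1 = xcoord v l - xcoord v l.+1) ->
  (0 < i <= n)%N -> (0 < j <= n)%N -> xcoord u i - xcoord v i = xcoord u j - xcoord v j.
Proof.
move=> uv; have W l : (0 < l <= n)%N -> xcoord u l - xcoord v l = xcoord u 1 - xcoord v 1.
  elim: l => // -[//|l] IH hl; rewrite -IH; last lia.
  have h : xcoord u l.+1 - xcoord u l.+2 = xcoord v l.+1 - xcoord v l.+2 by apply: uv; lia.
  have -> : xcoord u l.+2 = xcoord u l.+1 - (xcoord v l.+1 - xcoord v l.+2).
    by rewrite -h; ring.
  by ring.
by move=> /W -> /W ->.
Qed.

Lemma varpiE i : (0 < i <= n)%N -> varpi (simple i) = frow (fund_coefD i).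
Proof.
move=> hi; rewrite /varpi /fund_weight.
have Qw : Qspan P (frow (fund_coefD i)).
    apply: Qspan_frow => j; rewrite /fund_coefD; case: ifP => _; first exact: is_ratV.
    case: ifP => _; last exact: is_rat_nat.
    by apply: is_ratD => //; [exact: is_ratV|apply: is_ratN => //; exact: is_rat_nat].
have pw : {in P, forall b, pairing (frow (fund_coefD i)) (coroot b) = (b == simple i)%:R}.
  move=> b /simple_rootsP [j hj ->]; rewrite simple_inj //.
  have [lt|ge] := ltnP j n.
    by rewrite coroot_simple_lt ?xcoord_frow ?fund_coefD_lt //; lia.
  have -> : j = n by lia.
  by rewrite coroot_simple_last !xcoord_frow ?fund_coefD_last //; lia.
(* [xget] may return any solution [v]. It differs from [w] by a multiple of [ones], and the last
   coroot reads twice that multiple, which is therefore zero. *)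
case: xgetP => [v _ [_ pv]|/(_ (frow (fund_coefD i))) []//].
move: (frow _) pw => w pw.
have mP l : (0 < l <= n)%N -> simple l \in P.
  by move=> hl; apply/simple_rootsP; exists l.
have vw l : (0 < l < n)%N -> xcoord v l - xcoord v l.+1 = xcoord w l - xcoord w l.+1.
  by move=> hl; rewrite -!coroot_simple_lt // pv ?pw //; apply: mP; lia.
have vwn : xcoord v n.-1 + xcoord v n = xcoord w n.-1 + xcoord w n.
  by rewrite -!coroot_simple_last pv ?pw //; apply: mP; lia.
apply: xcoordP => l hl; apply/eqP; rewrite -subr_eq0.
rewrite (eq_simple_differences vw hl (_ : (0 < n <= n)%N)); last lia.
have h : xcoord v n.-1 - xcoord w n.-1 = xcoord v n - xcoord w n.
  by apply: eq_simple_differences => //; lia.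
have : (xcoord v n - xcoord w n) * 2 == 0.
  rewrite mulr_natr mulr2n -{1}h; apply/eqP.
  by rewrite addrACA -opprD vwn subrr.
by rewrite mulf_eq0 (negPf (two_neq0 char0)) orbF.
Qed.

(** The vector e_1 + ... + e_i projected to coordinate sum zero, i.e. a fundamental weight of type
    A_(n-1). *)
Definition fund_coefA (i j : nat) : k := (j <= i)%:R - i%:R / n%:R.

Lemma n_neq0 : n%:R != 0 :> k.
Proof. by rewrite natr_eq0_char0 //; lia. Qed.

Lemma varpi'E i : (0 < i < n)%N -> varpi' (simple i) = frow (fund_coefA i).
Proof.
move=> hi; rewrite /varpi' /fund_weight; have n0 := n_neq0.
have sum0 : \sum_(1 <= j < n.+1) fund_coefA i j = 0.
  rewrite sumrB sumr_const_nat subn1 /= -[(i%:R / n%:R) *+ n]mulr_natr mulfVK // -natr_sum.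
  rewrite (big_cat_nat (n := i.+1)) /=; try lia.
  rewrite (eq_big_nat _ _ (F2 := fun=> 1%N)); last by move=> j hj; lia.
  rewrite sum_nat_const_nat muln1 subn1 /= big_nat_cond big1 ?addn0 ?subrr //.
  by move=> j hj; lia.
have Qw : Qspan P' (frow (fund_coefA i)).
    apply: Qspan_frow' => // j; apply: is_ratD => //; first exact: is_rat_nat.
    by apply: is_ratN => //; apply: is_ratM => //; [exact: is_rat_nat|exact: is_ratV].
have pw : {in P', forall b, pairing (frow (fund_coefA i)) (coroot b) = (b == simple i)%:R}.
  move=> b /simple_roots'P [j hj ->]; rewrite simple_inj; try lia.
  rewrite coroot_simple_lt ?xcoord_frow; try lia.
  rewrite /fund_coefA opprB addrA subrK.
  by have [lt|gt|eq] := ltngtP j i; rewrite /= ?subrr // subr0.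
case: xgetP => [v _ [Qv pv]|/(_ (frow (fund_coefA i))) []//].
move: (frow _) Qw pw => w Qw pw.
have vw l : (0 < l < n)%N -> xcoord v l - xcoord v l.+1 = xcoord w l - xcoord w l.+1.
  by move=> hl; rewrite -!coroot_simple_lt // pv ?pw //; apply/simple_roots'P; exists l.
(* Here membership in the Q-span of pi' fixes the multiple of [ones]: the coordinate sum of [v - w]
   vanishes and is n times that multiple. *)
have vw0 : pairing (v - w) (fcol n (fun=> 1)) = 0.
  apply: (@pairing_Qspan _ _ P'); first exact: QspanB.
  move=> a /simple_roots'P [j hj ->]; rewrite simple_lt; last lia.
  by rewrite pairingB !pairing_eps ?subrr //; lia.
apply: xcoordP => l hl; apply/eqP; rewrite -subr_eq0.
have : (xcoord v l - xcoord w l) * n%:R == 0.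
  rewrite -vw0 [X in pairing X]row_eps_sum pairing_sum; apply/eqP.
  rewrite mulr_natr -[X in _ *+ X](subn0 n) -subSS -sumr_const_nat.
  apply: eq_big_nat => j hj; rewrite pairingZ pairing_eps // mulr1.
  rewrite /xcoord pairingB; apply: eq_simple_differences => //; lia.
by rewrite mulf_eq0 (negPf n0) orbF.
Qed.
End FundamentalWeights.

(** * The orbits and the lower bound *)

Section Orbits.
Variables (k : fieldType) (n : nat).
Hypothesis char0 : [pchar k] =i pred0.
Hypothesis n_ge2 : (2 <= n)%N.
Hypothesis n_even : ~~ odd n.
Notation e := (eps k n).
Notation simple := (simple k n).
Notation P := (simple_roots k n).
Notation P' := (simple_roots' k n).

(** The coefficient of [ones] in varpi_i - varpi'_i, where varpi'_n counts as 0; the case n-1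
    differs because varpi_(n-1) is a half-spin weight. *)
Definition level (i : nat) : k :=
  if i == n then 2%:R^-1 else if i == n.-1 then 2%:R^-1 - n%:R^-1 else i%:R / n%:R.

Lemma varpi_sub_varpi' i : (0 < i <= n)%N ->
  varpi (simple i) - (if (i < n)%N then varpi' (simple i) else 0) =
  level i *: ones k n.
Proof.
move=> hi; have n0 := n_neq0 char0 n_ge2.
rewrite varpiE //; case: ifP => lt; apply: xcoordP => j hj;
  rewrite /xcoord ?subr0 ?pairingB pairingZ -!/(xcoord _ _).
  rewrite varpi'E ?xcoord_frow //; try lia.
  rewrite /fund_coefD /fund_coefA /level mulr1.
  have -> : (i == n) = false by lia.
  case: eqP => [ein|_]; last by ring.
  have -> : i%:R = n%:R - 1 :> k by rewrite (_ : n = i.+1) -?natr1 ?addrK //; lia.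
  have -> : (j == n)%:R = 1 - (j <= i)%:R :> k.
    rewrite ein; case: eqP => [->|ne].
      by rewrite (_ : (n <= n.-1)%N = false) ?subr0 //; lia.
    by rewrite (_ : (j <= n.-1)%N) ?subrr //; lia.
  by field; rewrite n0 two_neq0.
rewrite !xcoord_frow // mulr1 /fund_coefD /level.
by have -> : (i == n) by lia.
Qed.

(** The action of i on the indices of simple roots, which is also that of ij: the flip of the
    A_(n-1) diagram, fixing n. *)
Definition tau (i : nat) : nat := if (i < n)%N then (n - i)%N else i.

Lemma jmap_id (a : 'rV[k]_n) : jmap a = a.
Proof. by rewrite /jmap longest_D // mulmxN mulmx1 opprK. Qed.

Lemma simple'_simple i : (0 < i <= n)%N -> (simple i \in P') = (i < n)%N.
Proof.
move=> hi; apply/simple_roots'P/idP => [[j hj /eqP]|lt].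
  by rewrite simple_inj // => [/eqP ->|]; lia.
by exists i => //; lia.
Qed.

Lemma imap_simple i : (0 < i <= n)%N -> imap (simple i) = simple (tau i).
Proof.
move=> hi; rewrite /imap simple'_simple // /tau; case: ifP => lt.
  rewrite /imap' simple_lt // mulmxBl !longest_A //; try lia.
  rewrite opprB simple_lt; last lia.
  by congr (e _ - e _); lia.
(* Only alpha_n is left. As j is the identity, r = 0 already gives a root outside pi', so the least
   r is 0. *)
case: pselect => [ex|[]]; last by exists 0%N; rewrite /jij jmap_id /= simple'_simple // lt.
case: ex_minnP => m _ /(_ 0%N); rewrite {1}/jij jmap_id /= simple'_simple // lt.
by move=> /(_ isT); rewrite leqn0 => /eqP ->; rewrite /jij jmap_id.
Qed.

Lemma tau_bound i : (0 < i <= n)%N -> (0 < tau i <= n)%N.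
Proof. rewrite /tau; case: ifP; lia. Qed.

Lemma tauK i : (0 < i <= n)%N -> tau (tau i) = i.
Proof. rewrite /tau => hi; repeat case: ifP; lia. Qed.

Lemma ij_simple i : (0 < i <= n)%N -> imap (jmap (simple i)) = simple (tau i).
Proof. by move=> hi; rewrite jmap_id imap_simple. Qed.

Lemma iter_ij_simple m i : (0 < i <= n)%N ->
  iter m (fun c => imap (jmap c)) (simple i) = simple (if odd m then tau i else i).
Proof.
move=> hi; elim: m => //= m ->; case: (odd m) => /=; rewrite ij_simple ?tauK //.
exact: tau_bound.
Qed.

Lemma ij_related_simple i j : (0 < i <= n)%N -> (0 < j <= n)%N ->
  ij_related (simple i) (simple j) <-> j = i \/ j = tau i.
Proof.
move=> hi hj; have ht := tau_bound hi; have htj := tau_bound hj; split.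
  case=> m []; rewrite iter_ij_simple // => /eqP; rewrite simple_inj //.
  - by case: (odd m) => /eqP ->; [right|left].
  - by case: (odd m).
  - by case: (odd m) => /eqP ->; rewrite ?tauK //; [right|left].
  - by case: (odd m).
case=> ->; first by exists 0%N; left.
by exists 1%N; left; rewrite /= ij_simple.
Qed.

(** [undup] accounts for the fixed points n/2 and n of [tau], whose orbits are singletons. *)
Definition orbit_index (i : nat) : seq nat := undup [:: i; tau i].

Lemma mem_ij_orbit i b : (0 < i <= n)%N ->
  (b \in ij_orbit (simple i)) = (b \in [seq simple j | j <- orbit_index i]).
Proof.
move=> hi; rewrite /ij_orbit !inE /=; apply/andP/mapP.
  move=> [/simple_rootsP [j hj ->] /asboolP /(ij_related_simple hi hj) h].
  by exists j => //; rewrite mem_undup !inE; case: h => ->; rewrite eqxx ?orbT.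
move=> [j]; rewrite mem_undup !inE => hj ->.
have bj : (0 < j <= n)%N by case/orP: hj => /eqP -> //; exact: tau_bound.
split; first by apply/simple_rootsP; exists j.
by apply/(ij_related_simple hi bj); case/orP: hj => /eqP ->; [left|right].
Qed.

Lemma orbit_index_bound i j : (0 < i <= n)%N -> j \in orbit_index i -> (0 < j <= n)%N.
Proof.
by move=> hi; rewrite mem_undup !inE => /orP[] /eqP -> //; exact: tau_bound.
Qed.

Lemma simple_inj_in i : (0 < i <= n)%N -> {in orbit_index i &, injective simple}.
Proof.
move=> hi x y /(orbit_index_bound hi) hx /(orbit_index_bound hi) hy /eqP.
by rewrite simple_inj // => /eqP.
Qed.

Lemma fsum_simple (A : {fset 'rV[k]_n}) (s : seq nat) (F : 'rV[k]_n -> 'rV[k]_n) :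
  uniq [seq simple j | j <- s] -> A =i [seq simple j | j <- s] ->
  \sum_(g <- A) F g = \sum_(j <- s) F (simple j).
Proof.
move=> us As; rewrite -(big_map simple xpredT F); apply: perm_big.
by apply: uniq_perm => //; exact: fset_uniq.
Qed.

(** The orbit is fixed by j and its part in pi' is stable under i, so each sum in [delta] occurs
    twice; the differences varpi_j - varpi'_j then combine. *)
Lemma delta_orbit i : (0 < i <= n)%N ->
  delta (ij_orbit (simple i)) = - ((\sum_(j <- orbit_index i) level j) *+ 2 *: ones k n).
Proof.
move=> hi; set s := orbit_index i; set s' := [seq j <- s | (j < n)%N].
have bs := orbit_index_bound hi.
have us : uniq [seq simple j | j <- s].
  by rewrite (map_inj_in_uniq (simple_inj_in hi)) undup_uniq.
have us' : uniq [seq simple j | j <- s'].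
  by apply: subseq_uniq us; apply: map_subseq; exact: filter_subseq.
have Os b : (b \in ij_orbit (simple i)) = (b \in [seq simple j | j <- s]).
  exact: mem_ij_orbit.
have O's' b : (b \in [fset g in ij_orbit (simple i) | g \in P']%fset) =
              (b \in [seq simple j | j <- s']).
  move: (ij_orbit _) Os => O Os; rewrite !inE /= Os; apply/andP/mapP => [[/mapP [j js ->] hj]|[j]].
    by exists j => //; rewrite mem_filter js -simple'_simple ?hj //; exact: bs.
  rewrite mem_filter => /andP [lt js] ->; rewrite map_f // simple'_simple //.
  exact: bs.
rewrite /delta (fsum_simple _ us Os) (fsum_simple _ us' O's').
rewrite (@fsum_simple _ s _ us); last first.
  move=> b; rewrite -Os; apply/imfsetP/idP => [[a /= ha ->]|hb]; rewrite ?jmap_id //.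
  by exists b; rewrite ?jmap_id.
rewrite (@fsum_simple _ s' _ us'); last first.
  have ts j : j \in s' -> tau j \in s'.
    rewrite !mem_filter /s !mem_undup !inE => /andP [lt] /orP[] /eqP jE; subst j.
      by rewrite eqxx orbT andbT /tau lt; lia.
    by rewrite tauK // eqxx andbT; move: lt; rewrite /tau; case: ifP => //; lia.
  have bs' j : j \in s' -> (0 < j <= n)%N by rewrite mem_filter => /andP [_ /bs].
  move=> b; apply/imfsetP/mapP => [[a /=]|[j js ->]].
    rewrite O's' => /mapP [j js ->] ->; rewrite imap_simple; last exact: bs'.
    by exists (tau j) => //; exact: ts.
  exists (simple (tau j)); first by rewrite /= O's' map_f // ts.
  by rewrite imap_simple ?tauK //; apply: bs'; rewrite ?ts.
rewrite !big_filter -scalerMnl scaler_suml.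
rewrite [in RHS](eq_big_seq _ (fun j js => esym (varpi_sub_varpi' (bs j js)))).
rewrite sumrB -big_mkcond mulr2n.
by rewrite -addrA addrACA opprD !opprB ![- _ + _]addrC.
Qed.

(** The factor 4 is the 2 of [delta_orbit] times the 2 in [ones] = 2 varpi_n. *)
Lemma delta_orbit_degree i (d : nat) : (0 < i <= n)%N ->
  (\sum_(j <- orbit_index i) level j) *+ 4 = d%:R ->
  delta (ij_orbit (simple i)) = - varpi (simple n) *+ d.
Proof.
move=> hi ed; have t0 := two_neq0 char0.
have -> : varpi (simple n) = 2%:R^-1 *: ones k n.
  rewrite -[RHS]/(2%:R^-1 *: ones k n) varpiE //; last lia.
  apply: xcoordP => j hj; rewrite [in RHS]/xcoord pairingZ -/(xcoord _ _).
  by rewrite !xcoord_frow // mulr1 /fund_coefD eqxx.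
rewrite delta_orbit // mulNrn -scaler_nat scalerA -ed; congr (- (_ *: _)).
by move: (\sum_(_ <- _) _) => x; field.
Qed.

Lemma orbit_index_lt i : (0 < i)%N -> (i.*2 < n)%N -> orbit_index i = [:: i; (n - i)%N].
Proof.
move=> i0 hi; rewrite /orbit_index /tau ifT /=; last lia.
by rewrite inE ifF //; lia.
Qed.

Lemma orbit_index_half : orbit_index n./2 = [:: n./2].
Proof.
rewrite /orbit_index /tau ifT /=; last lia.
have -> : (n - n./2)%N = n./2 by lia.
by rewrite inE eqxx.
Qed.

Lemma orbit_index_last : orbit_index n = [:: n].
Proof. by rewrite /orbit_index /tau ltnn /= inE eqxx. Qed.

(** * Degrees and enumeration of the orbits *)

Hypothesis n_ge6 : (6 <= n)%N.

Lemma level_lt i : (0 < i < n.-1)%N -> level i = i%:R / n%:R.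
Proof. by move=> hi; rewrite /level !ifF //; lia. Qed.

Lemma delta_last : delta (ij_orbit (simple n)) = - varpi (simple n) *+ 2.
Proof.
apply: delta_orbit_degree; first lia.
rewrite orbit_index_last big_seq1 /level eqxx.
by have t0 := two_neq0 char0; field.
Qed.

Lemma delta_half : delta (ij_orbit (simple n./2)) = - varpi (simple n) *+ 2.
Proof.
apply: delta_orbit_degree; first lia.
rewrite orbit_index_half big_seq1 level_lt; last lia.
have n0 := n_neq0 char0 n_ge2.
rewrite [in X in _ / X](_ : n = n./2 + n./2)%N ?natrD; last lia.
have h0 : n./2%:R != 0 :> k by rewrite natr_eq0_char0 //; lia.
by have t0 := two_neq0 char0; field; rewrite -natrD natr_eq0_char0 //; lia.
Qed.

Lemma delta_first : delta (ij_orbit (simple 1)) = - varpi (simple n) *+ 2.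
Proof.
apply: delta_orbit_degree; first lia.
(* The orbit is {1, n-1}, with levels 1/n and 1/2 - 1/n: the exceptional value at n-1 brings the
   total down to 1/2. *)
rewrite orbit_index_lt //; last lia.
rewrite big_cons big_seq1 level_lt; last lia.
rewrite /level ifF; last lia.
rewrite ifT; last lia.
have n0 := n_neq0 char0 n_ge2.
by have t0 := two_neq0 char0; field; rewrite n0 t0.
Qed.

Lemma delta_mid i : (1 < i)%N -> (i.*2 < n)%N ->
  delta (ij_orbit (simple i)) = - varpi (simple n) *+ 4.
Proof.
move=> i1 hi; apply: delta_orbit_degree; first lia.
rewrite orbit_index_lt //; last lia.
rewrite big_cons big_seq1 !level_lt; try lia.
rewrite natrB; last lia.
have n0 := n_neq0 char0 n_ge2.
by field.
Qed.

(** The three orbits of weight -2 varpi_n come first, then those of weight -4 varpi_n. *)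
Definition orbit_reps : seq nat := [:: 1%N; n./2; n] ++ index_iota 2 n./2.

Lemma orbit_reps_bound i : i \in orbit_reps -> (0 < i <= n./2)%N \/ i = n.
Proof.
rewrite mem_cat !inE mem_index_iota => h.
by have [->|ne] := eqVneq i n; [right|left; lia].
Qed.

Lemma Epi'_perm : perm_eq (Epi' k n) [seq ij_orbit (simple i) | i <- orbit_reps].
Proof.
have bnd i : i \in orbit_reps -> (0 < i <= n)%N by move/orbit_reps_bound; lia.
have self i : (0 < i <= n)%N -> simple i \in ij_orbit (simple i).
  by move=> hi; rewrite mem_ij_orbit // map_f // mem_undup mem_head.
have tauE i j : (0 < i <= n)%N -> (0 < j <= n)%N ->
    simple i \in ij_orbit (simple j) -> i = j \/ i = tau j.
  move=> hi hj; rewrite mem_ij_orbit // => /mapP [l ls /eqP].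
  rewrite simple_inj // ?(orbit_index_bound hj ls) // => /eqP ->.
  by move: ls; rewrite mem_undup !inE => /orP[] /eqP ->; [left|right].
have orbit_tau i : (0 < i <= n)%N -> ij_orbit (simple (tau i)) = ij_orbit (simple i).
  move=> hi; apply/fsetP => b; have ht := tau_bound hi; rewrite !mem_ij_orbit //.
  apply: eq_mem_map => j; rewrite !mem_undup !inE tauK //; exact: orbC.
apply: uniq_perm; first exact: fset_uniq.
  rewrite map_inj_in_uniq.
    rewrite cat_uniq iota_uniq andbT /= !inE !negb_or.
    rewrite !andbT -!andbA; apply/and4P; split; try lia.
    apply/hasPn => i; rewrite mem_index_iota !inE; lia.
  move=> i j hi hj eO; have := self i (bnd i hi); rewrite eO => /tauE.
  move=> /(_ (bnd i hi) (bnd j hj)) [//|].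
  (* [tau] sends 1..n/2 into n/2..n-1 and fixes n, so two representatives in one orbit coincide. *)
  move/orbit_reps_bound: hi => hi; move/orbit_reps_bound: hj => hj.
  rewrite /tau; case: ifP; lia.
move=> O; apply/imfsetP/mapP.
  move=> [a /= /simple_rootsP [i hi ->] ->].
  have [le|gt] := leqP i n./2.
    exists i => //; rewrite mem_cat !inE mem_index_iota; lia.
  have [lt|ge] := ltnP i n.
    exists (tau i); last by rewrite orbit_tau.
    rewrite /tau lt mem_cat !inE mem_index_iota; lia.
  by exists i => //; rewrite mem_cat !inE mem_index_iota; lia.
move=> [i /bnd hi ->]; exists (simple i) => //=.
by apply/simple_rootsP; exists i.
Qed.

Lemma Epi'_delta_perm : perm_eq [seq delta G | G <- Epi' k n]
  (nseq 3 (- varpi (simple n) *+ 2) ++ nseq (n./2 - 2) (- varpi (simple n) *+ 4)).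
Proof.
apply: (perm_trans (perm_map _ Epi'_perm)); rewrite -map_comp.
suff -> : [seq delta (ij_orbit (simple i)) | i <- orbit_reps] =
    nseq 3 (- varpi (simple n) *+ 2) ++ nseq (n./2 - 2) (- varpi (simple n) *+ 4) by [].
rewrite map_cat /= delta_first delta_half delta_last; congr [:: _, _, _ & _].
apply: (@eq_from_nth _ 0) => [|j]; rewrite size_map size_iota ?size_nseq // => hj.
rewrite (nth_map 0%N) ?size_iota // nth_iota // nth_nseq hj delta_mid //; lia.
Qed.

End Orbits.

(** * The improved upper bound *)

Section UpperBound.
Variables (k : fieldType) (n : nat).
Hypothesis char0 : [pchar k] =i pred0.
Hypothesis n_even : ~~ odd n.
Hypothesis n_ge6 : (6 <= n)%N.
Notation e := (eps k n).
Notation simple := (simple k n).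
Notation P' := (simple_roots' k n).
Notation S := (roots_S k n).

Lemma n_ge2 : (2 <= n)%N.
Proof. exact: leq_trans n_ge6. Qed.

(** Orthogonality to S forces this vector: the sum and the difference of e_(n-4) and e_(n-5) give
    zeros there, hence at n-2. The entries at n, n-3 and the even places up to n-6 are equal, those
    at n-1 and the odd places up to n-7 opposite. Pairing to 1 with [ones] fixes the scale. *)
Definition dual_coef (i : nat) : k :=
  if (i <= n - 6)%N then if odd i then -1 else 1
  else if (i == n - 3)%N || (i == n) then 1
  else if i == n.-1 then -1 else 0.

Notation H := (fcol n dual_coef).

Lemma dual_coef_odd i : odd i -> (i <= n - 6)%N -> dual_coef i = -1.
Proof. by rewrite /dual_coef => -> ->. Qed.

Lemma dual_coef_even i : ~~ odd i -> (i <= n - 6)%N -> dual_coef i = 1.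
Proof. by rewrite /dual_coef => /negPf -> ->. Qed.

Lemma dual_coef_top : [/\ dual_coef n = 1, dual_coef (n - 1) = -1, dual_coef (n - 2) = 0,
  dual_coef (n - 3) = 1 & dual_coef (n - 4) = 0] /\ dual_coef (n - 5) = 0.
Proof.
split; first split; rewrite /dual_coef ifF; try lia.
- by rewrite ifT //; lia.
- by rewrite ifF ?ifT //; lia.
- by rewrite !ifF //; lia.
- by rewrite ifT //; lia.
- by rewrite !ifF //; lia.
- by rewrite !ifF //; lia.
Qed.

Lemma pairing_ones_dual : pairing (ones k n) H = 1.
Proof.
rewrite pairing_frow (eq_bigr dual_coef) => [|i _]; last by rewrite mul1r.
rewrite (@big_cat_nat _ _ _ (n - 5)) /=; try lia.
(* The first n-6 entries cancel in pairs, leaving 0 + 0 + 1 + 0 - 1 + 1. *)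
have alt m : \sum_(1 <= i < m.*2.+1) (if odd i then -1 else 1 : k) = 0.
  elim: m => [|m IH]; first by rewrite big_geq.
  rewrite doubleS big_nat_recr // big_nat_recr // IH /= odd_double /=.
  by rewrite add0r addNr.
rewrite (eq_big_nat _ _ (F2 := fun i => if odd i then -1 else 1)); last first.
  by move=> i hi; rewrite /dual_coef ifT //; lia.
rewrite {1}(_ : n - 5 = (n./2 - 3).*2.+1)%N ?alt ?add0r; last lia.
have [[c0 c1 c2 c3 c4] c5] := dual_coef_top.
rewrite big_ltn; last lia.
rewrite (_ : (n - 5).+1 = n - 4)%N; last lia.
rewrite big_ltn; last lia.
rewrite (_ : (n - 4).+1 = n - 3)%N; last lia.
rewrite big_ltn; last lia.
rewrite (_ : (n - 3).+1 = n - 2)%N; last lia.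
rewrite big_ltn; last lia.
rewrite (_ : (n - 2).+1 = n - 1)%N; last lia.
rewrite big_ltn; last lia.
rewrite (_ : (n - 1).+1 = n)%N; last lia.
rewrite big_nat1 c0 c1 c2 c3 c4 c5.
by rewrite !add0r addNr addr0.
Qed.

Lemma roots_S_dual s : s \in S -> pairing s H = 0.
Proof.
have [[c0 c1 c2 c3 c4] c5] := dual_coef_top.
rewrite /roots_S !mem_cat => /or4P[].
- case/mapP => i; rewrite mem_index_iota => hi ->.
  rewrite pairingD !pairing_eps; try lia.
  have [le|gt] := leqP (2 * i) (n - 6).
    by rewrite dual_coef_odd ?dual_coef_even ?addNr //; lia.
  (* The last sum in S, for i = n/2 - 2, falls on the two zero entries. *)
  rewrite (_ : 2 * i - 1 = n - 5)%N; last lia.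
  rewrite (_ : 2 * i = n - 4)%N; last lia.
  by rewrite c4 c5 addr0.
- rewrite !inE => /or4P[] /eqP ->; rewrite ?pairingB ?pairingD !pairing_eps; try lia.
  + by rewrite c3 c1 subrr.
  + by rewrite c0 c3 subrr.
  + by rewrite c2 c4 subrr.
  + by rewrite c4 c5 subrr.
- case: eqP => // ne; rewrite inE => /eqP ->; rewrite pairingB !pairing_eps; try lia.
  by rewrite c3 dual_coef_even ?subrr //; lia.
- case/mapP => i; rewrite mem_index_iota => hi ->.
  rewrite pairingB !pairing_eps; try lia.
  by rewrite !dual_coef_even ?subrr //; lia.
Qed.

(** A congruence modulo the Q-span of S. The multiple of e_n is the only possible one, since [H]
    kills S and pairs to 1 with e_n. *)
Definition reduces (v : 'rV[k]_n) : Prop := Qspan S (v - pairing v H *: e n).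

Lemma reducesD u v : reduces u -> reduces v -> reduces (u + v).
Proof.
by rewrite /reduces pairingD scalerDl opprD addrACA; exact: QspanD.
Qed.

Lemma reducesZ c v : is_rat c -> reduces v -> reduces (c *: v).
Proof.
by rewrite /reduces pairingZ -scalerA -scalerBr; exact: QspanZ.
Qed.

Lemma reducesN v : reduces v -> reduces (- v).
Proof. by rewrite -scaleN1r; apply: reducesZ; apply: is_ratN => //; exact: (is_rat_nat _ 1). Qed.

Lemma reducesB u v : reduces u -> reduces v -> reduces (u - v).
Proof. by move=> ru /reducesN; exact: reducesD. Qed.

Lemma reduces_mem s : s \in S -> reduces s.
Proof. by move=> hs; rewrite /reduces roots_S_dual // scale0r subr0; exact: Qspan_mem. Qed.

(** The elements of S link the indices: n to n-3, then to n-1 and n-6, n-8, ..., 2; each odd index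
    up to n-7 to its successor. The indices n-4 and n-5 are settled separately, and n-2 follows from
    n-4. *)
Lemma reduces_eps i : (0 < i <= n)%N -> reduces (e i).
Proof.
have [[c0 _ _ _ _] _] := dual_coef_top.
have S1 j : (0 < j < n./2 - 1)%N -> reduces (e (2 * j - 1)%N + e (2 * j)%N).
  move=> hj; apply: reduces_mem; rewrite /roots_S mem_cat; apply/orP; left.
  by apply/mapP; exists j => //; rewrite mem_index_iota.
have S2 s : s \in [:: e (n - 3)%N + e (n - 1)%N; e n - e (n - 3)%N;
         e (n - 2)%N - e (n - 4)%N; e (n - 4)%N - e (n - 5)%N] -> reduces s.
  by move=> hs; apply: reduces_mem; rewrite /roots_S !mem_cat hs orbT.
have S3 : n != 6%N -> reduces (e (n - 3)%N - e (n - 6)%N).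
  by move=> /negPf ne; apply: reduces_mem; rewrite /roots_S !mem_cat ne mem_head !orbT.
have S4 j : (2 < j < n./2 - 1)%N -> reduces (e (n - 2 * j)%N - e (n - 2 * j - 2)%N).
  move=> hj; apply: reduces_mem; rewrite /roots_S !mem_cat; apply/orP; right.
  apply/orP; right; apply/orP; right.
  by apply/mapP; exists j => //; rewrite mem_index_iota.
have r0 : reduces (e n).
  rewrite /reduces pairing_eps ?c0 ?scale1r ?subrr; [exact: Qspan0|lia].
have r3 : reduces (e (n - 3)%N).
  rewrite -[e (n - 3)%N](subKr (e n)); apply: reducesB => //; apply: S2.
  by rewrite !inE eqxx !orbT.
have r1 : reduces (e (n - 1)%N).
  rewrite -[e (n - 1)%N](addKr (e (n - 3)%N)) addrC; apply: reducesB => //; apply: S2.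
  by rewrite !inE eqxx.
have r45 : reduces (e (n - 4)%N - e (n - 5)%N) by apply: S2; rewrite !inE eqxx !orbT.
have r4 : reduces (e (n - 4)%N).
  (* Both the difference and the sum of these two vectors lie in S. *)
  have -> : e (n - 4)%N = 2%:R^-1 *: ((e (n - 4)%N - e (n - 5)%N) + (e (n - 5)%N + e (n - 4)%N)).
    rewrite addrA subrK -mulr2n -scaler_nat scalerA mulVf ?scale1r //; exact: two_neq0.
  apply: reducesZ; first exact: is_ratV.
  apply: reducesD => //.
  rewrite (_ : n - 5 = 2 * (n./2 - 2) - 1)%N; last lia.
  by rewrite (_ : n - 4 = 2 * (n./2 - 2))%N; [apply: S1|]; lia.
have r5 : reduces (e (n - 5)%N) by rewrite -[e (n - 5)%N](subKr (e (n - 4)%N)); exact: reducesB.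
have r2 : reduces (e (n - 2)%N).
  rewrite -[e (n - 2)%N](subrK (e (n - 4)%N)); apply: reducesD => //; apply: S2.
  by rewrite !inE eqxx !orbT.
have re j : (2 < j < n./2)%N -> reduces (e (n - 2 * j)%N).
  (* The chain starts at n-6, reached from n-3; the bound on the index excludes n = 6 there. *)
  elim: j => // j IH hj; have [j2|nj2] := eqVneq j 2%N.
    rewrite j2 -[e _](subKr (e (n - 3)%N)); apply: reducesB => //; apply: S3; lia.
  rewrite -[e _](subKr (e (n - 2 * j)%N)); apply: reducesB; first by apply: IH; lia.
  by rewrite (_ : n - 2 * j.+1 = n - 2 * j - 2)%N; [apply: S4|]; lia.
move=> hi; have [le|gt] := leqP i (n - 6).
  have [oi|ei] := boolP (odd i); last first.
    by rewrite (_ : i = n - 2 * (n./2 - i./2))%N; [apply: re|]; lia.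
  rewrite -[e i](addrK (e i.+1)); apply: reducesB.
    rewrite (_ : i.+1 = 2 * i.+1./2)%N; last lia.
    by rewrite {1}(_ : i = 2 * i.+1./2 - 1)%N; [apply: S1|]; lia.
  by rewrite (_ : i.+1 = n - 2 * (n./2 - i.+1./2))%N; [apply: re|]; lia.
have : i \in [:: n; n - 1; n - 2; n - 3; n - 4; n - 5]%N by rewrite !inE; lia.
by rewrite !inE => /or4P[/eqP-> //|/eqP-> //|/eqP-> //|/or3P[] /eqP ->].
Qed.

(** * The map t and the weights of T *)

Lemma pairing_span (X : seq 'cV[k]_n) v : {in X, forall h, pairing v h = 0} ->
  {in <<X>>%VS, forall h, pairing v h = 0}.
Proof.
move=> v0 h hX; rewrite (coord_span (X := in_tuple X) hX).
rewrite /pairing mulmx_sumr summxE big1 // => i _.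
by rewrite -scalemxAr mxE [_ 0 0]v0 ?mulr0 // mem_nth.
Qed.

(** The candidate reduces and pairs to 0 with [H], so it lies in the Q-span of S. Two solutions
    differ by a multiple of [ones] in that span, and pairing with [H] shows the multiple to be
    zero. *)
Lemma tmapE g : is_rat (pairing g H) -> reduces g ->
  tmap g = pairing g H *: ones k n - g.
Proof.
set c := pairing g H => cr gr; set w := _ - g.
have n2 := n_ge2.
have Qw : Qspan S w.
  have : reduces w.
    apply: reducesB => //; apply: reducesZ => //; rewrite /ones frow_sum.
    rewrite big_seq; elim/big_rec: _ => [|i x hi rx].
      by rewrite /reduces /pairing mul0mx mxE scale0r subrr; exact: Qspan0.
    rewrite scale1r; apply: reducesD => //; apply: reduces_eps.
    by rewrite mem_index_iota in hi.
  by rewrite /reduces pairingB pairingZ pairing_ones_dual mulr1 subrr scale0r subr0.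
have hw : {in hLambda k n, forall h, pairing (g + w) h = 0}.
  apply: pairing_span => h /mapP [a /simple_roots'P [i hi ->] ->].
  rewrite addrC subrK coroot_simple_lt // /xcoord !pairingZ -!/(xcoord _ _).
  by rewrite !xcoord_frow ?subrr //; lia.
clearbody w; rewrite /tmap; case: xgetP => [v _ [Qv hv]|/(_ w) []//].
have eqc l : (0 < l < n)%N ->
    xcoord (g + v) l - xcoord (g + v) l.+1 = xcoord (g + w) l - xcoord (g + w) l.+1.
  move=> hl; rewrite -!coroot_simple_lt // hv ?hw //.
    by apply: memv_span; rewrite map_f //; apply/simple_roots'P; exists l.
  by apply: memv_span; rewrite map_f //; apply/simple_roots'P; exists l.
pose d := xcoord (g + v) n - xcoord (g + w) n.
have vw : v - w = d *: ones k n.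
  apply: xcoordP => l hl; rewrite [RHS]/xcoord pairingZ -/(xcoord _ _) xcoord_frow // mulr1.
  rewrite /d -(eq_simple_differences n2 eqc hl); last lia.
  by rewrite /xcoord -!pairingB opprD addrACA subrr add0r.
have : pairing (v - w) H = 0.
  by apply: (@pairing_Qspan _ _ S); [exact: QspanB|exact: roots_S_dual].
rewrite vw pairingZ pairing_ones_dual mulr1 => d0.
by apply/eqP; rewrite -subr_eq0 vw d0 scale0r.
Qed.

Lemma varpi_last_double : varpi (simple n) *+ 2 = ones k n.
Proof.
have n2 := n_ge2; rewrite varpiE //; last lia.
apply: xcoordP => i hi; rewrite mulr2n /xcoord pairingD -!/(xcoord _ _).
by rewrite !xcoord_frow // /fund_coefD eqxx half_half.
Qed.

Lemma upper_weight g (d : nat) : pairing g H = d%:R -> reduces g ->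
  - (g + tmap g) = - varpi (simple n) *+ d.*2.
Proof.
move=> gd rg; rewrite tmapE //; last by rewrite gd; exact: is_rat_nat.
by rewrite addrC subrK gd scaler_nat -varpi_last_double -mulrnA mul2n mulNrn.
Qed.

(** The entries of [H] are 1 and -1 for e_(n-3) - e_(n-1) and for each pair of the final family,
    giving 2; each of the other three elements meets one entry 0 and one entry 1. *)
Lemma roots_T_upper_weights : [seq - (g + tmap g) | g <- roots_T k n] =
  let lam := - varpi (simple n) in
  [:: lam *+ 4; lam *+ 2; lam *+ 2; lam *+ 2] ++ nseq (n./2 - 3) (lam *+ 4).
Proof.
have [[c0 c1 c2 c3 c4] c5] := dual_coef_top.
have rB i j : (0 < i <= n)%N -> (0 < j <= n)%N -> reduces (e i - e j).
  by move=> hi hj; apply: reducesB; exact: reduces_eps.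
rewrite /roots_T map_cat /=; congr [:: _, _, _, _ & _].
- apply: (@upper_weight _ 2); last by apply: rB; lia.
  by rewrite pairingB !pairing_eps ?c3 ?c1 ?opprK //; lia.
- apply: (@upper_weight _ 1); last by apply: reducesD; apply: reduces_eps; lia.
  by rewrite pairingD !pairing_eps ?c2 ?c0 ?add0r //; lia.
- apply: (@upper_weight _ 1); last by apply: rB; lia.
  by rewrite pairingB !pairing_eps ?c5 ?c0 ?subr0 //; lia.
- apply: (@upper_weight _ 1); last by apply: rB; lia.
  by rewrite pairingB !pairing_eps ?c3 ?c4 ?subr0 //; lia.
rewrite -map_comp; apply: (@eq_from_nth _ 0) => [|j].
  by rewrite size_map size_iota size_nseq.
rewrite size_map size_iota => hj.
rewrite (nth_map 0%N) ?size_iota // nth_iota // nth_nseq hj /=.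
apply: (@upper_weight _ 2); last by apply: rB; lia.
rewrite pairingB !pairing_eps; try lia.
by rewrite [X in _ - X]dual_coef_odd ?dual_coef_even ?opprK //; lia.
Qed.

End UpperBound.

(** * Comparison of the two products *)

Theorem lemma10p7 (k : closedFieldType) (n : nat)
    (char0 : [pchar k] =i pred0) (n_ge6 : (6 <= n)%N) (n_even : ~~ odd n) :
  let varpi_n := varpi (simple k n n) in
  Bprime k n = chA k n /\
  Bprime k n = fmul (fexp (geom (- (varpi_n *+ 2))) 3)
                    (fexp (geom (- (varpi_n *+ 4))) (n./2 - 2)).
Proof.
have n2 : (2 <= n)%N by exact: leq_trans n_ge6.
move=> varpi_n; rewrite {}/varpi_n -!mulNrn; set lam := - varpi (simple k n n).
have lam0 : lam != 0.
  (* varpi_n is nonzero because its double [ones] pairs to 1 with the dual vector. *)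
  apply/eqP => l0; have := pairing_ones_dual k n_even n_ge6.
  rewrite -varpi_last_double // -[varpi _]opprK -/lam l0 oppr0 mul0rn.
  by rewrite /pairing mul0mx mxE => /eqP; rewrite eq_sym oner_eq0.
have ray d : in_ray lam (lam *+ d) by apply/asboolP; exists d.
set target := nseq 3 (lam *+ 2) ++ nseq (n./2 - 2) (lam *+ 4).
have rt : all (in_ray lam) target by rewrite all_cat !all_nseq !ray !orbT.
have Bt : Bprime k n = geom_prod target.
  rewrite /Bprime -(big_map (fun g => - (g + tmap g)) xpredT (@geom k n)).
  rewrite roots_T_upper_weights //= -/lam.
  apply/esym/(geom_prod_perm char0 lam0 rt).
  (* The extra factor is that of e_(n-3) - e_(n-1), which stands first in T and is moved past the
     three of weight -2 varpi_n. *)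
  rewrite /target (_ : n./2 - 2 = (n./2 - 3).+1)%N; last lia.
  exact: permEl (perm_catCA (nseq 3 (lam *+ 2)) [:: lam *+ 4] (nseq (n./2 - 3) (lam *+ 4))).
have At : chA k n = geom_prod target.
  rewrite /chA -(big_map (@delta k n) xpredT (@geom k n)).
  by apply/esym/(geom_prod_perm char0 lam0 rt); rewrite perm_sym; exact: Epi'_delta_perm.
split; first by rewrite Bt At.
by rewrite Bt /target (geom_prod_cat char0 lam0) ?geom_prod_nseq // all_nseq ray orbT.
Qed.
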